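(* Every connected Kähler surface of Calabi type is a QCH Kähler surface.
   Context: A Kähler surface is a Kähler manifold $(M,g,J)$ of real dimension $4$, with Kähler form $\omega=g(J\cdot,\cdot)$. The curvature tensor is $R(X,Y)Z=([\nabla_X,\nabla_Y]-\nabla_{[X,Y]})Z$, $R(X,Y,Z,W)=g(R(X,Y)Z,W)$. A Kähler surface $(M,g,J)$ is of Calabi type if it admits a (nowhere) non-vanishing Hamiltonian Killing vector field $\xi$ (Hamiltonian with respect to $\omega$) such that the almost Hermitian pair $(g,I)$, with $I$ equal to $J$ on the distribution spanned by $\xi$ and $J\xi$ and to $-J$ on the orthogonal distribution, is conformally Kähler, i.e. some metric $f^2g$ with $f>0$ a smooth function is Kähler with respect to $I$. A connected Kähler surface $(M,g,J)$ is a QCH Kähler surface (QCH manifold) if there is a global smooth $J$-invariant $2$-dimensional distribution $\mathcal{D}\subset TM$ such that, for every $x\in M$ and every unit vector $X\in T_xM$, the holomorphic sectional curvature $R(X,JX,JX,X)$ depends only on $x$ and on $|X_{\mathcal{D}}|$, where $X_{\mathcal{D}}$ is the orthogonal projection of $X$ on $\mathcal{D}$. *)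

(* Defs.v *)
From mathcomp Require Import all_boot all_order all_algebra.
From mathcomp Require Import all_classical all_reals all_analysis.
Import Order.TTheory GRing.Theory Num.Theory.
Import numFieldNormedType.Exports.

Set Implicit Arguments.
Unset Strict Implicit.
Unset Printing Implicit Defensive.

Local Open Scope classical_set_scope.
Local Open Scope ring_scope.

(** * Smooth maps on open sets *)

Section Smooth.
Context {R : realType} {V W : normedModType R}.

Fixpoint Ck_on (k : nat) (O : set V) (f : V -> W) : Prop :=
  (forall x, O x -> {for x, continuous f}) /\
  if k is k'.+1 then
    forall v, (forall x, O x -> derivable f x v) /\ Ck_on k' O ('D_v f)
  else True.

Definition smooth_on (O : set V) (f : V -> W) : Prop := forall k, Ck_on k O f.

End Smooth.

(** * Smooth manifolds *)

(* [chart_inv i] is only meaningful on [chart_img i]; the second countable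
   Hausdorff space [mspace] need not be connected. *)
Record smooth_manifold (R : realType) (n : nat) := SmoothManifold {
  mspace :> topologicalType;
  chart : Type;
  chart_dom : chart -> set mspace;
  chart_map : chart -> mspace -> 'rV[R]_n;
  chart_inv : chart -> 'rV[R]_n -> mspace;
  chart_img : chart -> set 'rV[R]_n := fun i => chart_map i @` chart_dom i;
  mspace_hausdorff : hausdorff_space mspace;
  mspace_countable : @second_countable mspace;
  chart_cover : forall x, exists i, chart_dom i x;
  chart_dom_open : forall i, open (chart_dom i);
  chart_img_open : forall i, open (chart_img i);
  chart_mapK : forall i x, chart_dom i x -> chart_inv i (chart_map i x) = x;
  chart_map_continuous :
    forall i x, chart_dom i x -> {for x, continuous (chart_map i)};
  chart_inv_continuous :
    forall i y, chart_img i y -> {for y, continuous (chart_inv i)};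
  chart_smooth : forall i j,
    smooth_on (chart_map i @` (chart_dom i `&` chart_dom j))
      (chart_map j \o chart_inv i)
}.

Arguments chart {R n}.
Arguments chart_dom {R n}.
Arguments chart_map {R n}.
Arguments chart_inv {R n}.
Arguments chart_img {R n}.

Section Tensors.
Context {R : realType} {n : nat} (M : smooth_manifold R n).

(* A tangent vector at [x] is a row vector of components in a chart [i] around
   [x]; [push i j x] is the resulting change of components from [i] to [j],
   i.e. the differential of the transition map.  Accordingly a tensor field is
   a family, indexed by the charts, of functions of the coordinates [y] (only
   relevant for [y] in [chart_img M i]) which agree on overlaps. *)
Definition push (i j : chart M) (x : M) (v : 'rV[R]_n) : 'rV[R]_n :=
  'D_v (chart_map M j \o chart_inv M i) (chart_map M i x).

Definition overlap (i j : chart M) (x : M) : Prop :=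
  chart_dom M i x /\ chart_dom M j x.

Definition smooth_function (f : M -> R) : Prop :=
  forall i, smooth_on (chart_img M i) (f \o chart_inv M i).

Definition vector_field (X : chart M -> 'rV[R]_n -> 'rV[R]_n) : Prop :=
  (forall i, smooth_on (chart_img M i) (X i)) /\
  (forall i j x, overlap i j x ->
     X j (chart_map M j x) = push i j x (X i (chart_map M i x))).

(* An endomorphism acts on row vectors on the right, [v |-> v *m A]. *)
Definition endo_field (A : chart M -> 'rV[R]_n -> 'M[R]_n) : Prop :=
  (forall i, smooth_on (chart_img M i) (A i)) /\
  (forall i j x v, overlap i j x ->
     push i j x (v *m A i (chart_map M i x)) =
     push i j x v *m A j (chart_map M j x)).

Definition ip (G : 'M[R]_n) (u v : 'rV[R]_n) : R := (u *m G *m v^T) 0 0.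

Definition inorm (G : 'M[R]_n) (v : 'rV[R]_n) : R := Num.sqrt (ip G v v).

Definition riemannian_metric (g : chart M -> 'rV[R]_n -> 'M[R]_n) : Prop :=
  [/\ forall i, smooth_on (chart_img M i) (g i),
      forall i y, chart_img M i y -> (g i y)^T = g i y,
      forall i y v, chart_img M i y -> v != 0 -> 0 < ip (g i y) v v
    & forall i j x u v, overlap i j x ->
        ip (g j (chart_map M j x)) (push i j x u) (push i j x v) =
        ip (g i (chart_map M i x)) u v].

(* Smooth distributions of rank [k]: [D i y] is the set of components of the
   tangent vectors in the distribution, locally the row space of a smooth
   [k]-frame. *)
Definition smooth_distribution (k : nat)
    (D : chart M -> 'rV[R]_n -> set 'rV[R]_n) : Prop :=
  (forall i y, chart_img M i y ->
     exists (O : set 'rV[R]_n) (F : 'rV[R]_n -> 'M[R]_(k, n)),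
       [/\ open O, O y, O `<=` chart_img M i, smooth_on O F
         & forall z, O z -> row_free (F z) /\
             D i z = [set v | (v <= F z)%MS]]) /\
  (forall i j x v, overlap i j x ->
     D i (chart_map M i x) v <-> D j (chart_map M j x) (push i j x v)).

End Tensors.

(** * Calculus of vector fields in a chart *)

Section Calculus.
Context {R : realType} {n : nat}.
Local Notation vec := 'rV[R]_n.
Implicit Types (X Y Z : vec -> vec) (g A : vec -> 'M[R]_n) (y u v w : vec).

Definition bracket X Y : vec -> vec :=
  fun y => 'D_(X y) Y y - 'D_(Y y) X y.

Definition nijenhuis A X Y : vec -> vec :=
  let ap Z := fun y => Z y *m A y in
  fun y => bracket (ap X) (ap Y) y - bracket (ap X) Y y *m A y
           - bracket X (ap Y) y *m A y - bracket X Y y.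

Definition ext_deriv2 (om : vec -> vec -> vec -> R) X Y Z : vec -> R :=
  fun y => 'D_(X y) (fun q => om q (Y q) (Z q)) y
         + 'D_(Y y) (fun q => om q (Z q) (X q)) y
         + 'D_(Z y) (fun q => om q (X q) (Y q)) y
         - om y (bracket X Y y) (Z y)
         - om y (bracket Y Z y) (X y)
         - om y (bracket Z X y) (Y y).

Definition lie_metric X g Y Z : vec -> R :=
  fun y => 'D_(X y) (fun q => ip (g q) (Y q) (Z q)) y
         - ip (g y) (bracket X Y y) (Z y) - ip (g y) (Y y) (bracket X Z y).

(* The vector w with 2 g(w, z) = u(g(v, z)) + v(g(u, z)) - z(g(u, v)) for all
   constant u, v, z. *)
Definition christoffel g y u v : vec :=
  2^-1 *: (\row_c ('D_u (fun q => ip (g q) v (delta_mx 0 c)) y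
                 + 'D_v (fun q => ip (g q) u (delta_mx 0 c)) y
                 - 'D_(delta_mx 0 c) (fun q => ip (g q) u v) y))
       *m invmx (g y).

(* Levi-Civita connection of [g]. *)
Definition nabla g X Y : vec -> vec :=
  fun y => 'D_(X y) Y y + christoffel g y (X y) (Y y).

Definition curv_op g X Y Z : vec -> vec :=
  fun y => nabla g X (nabla g Y Z) y - nabla g Y (nabla g X Z) y
           - nabla g (bracket X Y) Z y.

(* The curvature tensor at [y], evaluated by extending the tangent vectors to
   vector fields with constant components; by tensoriality the choice of
   extension is irrelevant. *)
Definition curv g y u v w z : R :=
  ip (g y) (curv_op g (cst u) (cst v) (cst w) y) z.

Definition kahler_form g A y u v : R := ip (g y) (u *m A y) v.

End Calculus.

(** * Kähler surfaces *)

Section Kahler.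
Context {R : realType} (M : smooth_manifold R 4).
Implicit Types (g J : chart M -> 'rV[R]_4 -> 'M[R]_4).

Definition kahler_surface g J : Prop :=
  [/\ riemannian_metric g,
      endo_field J,
      forall i y, chart_img M i y ->
        J i y *m J i y = - 1%:M /\
        forall u v, ip (g i y) (u *m J i y) (v *m J i y) = ip (g i y) u v,
      forall i X Y, smooth_on (chart_img M i) X -> smooth_on (chart_img M i) Y ->
        forall y, chart_img M i y -> nijenhuis (J i) X Y y = 0
    & forall i X Y Z, smooth_on (chart_img M i) X ->
        smooth_on (chart_img M i) Y -> smooth_on (chart_img M i) Z ->
        forall y, chart_img M i y ->
          ext_deriv2 (kahler_form (g i) (J i)) X Y Z y = 0].

Definition killing g (xi : chart M -> 'rV[R]_4 -> 'rV[R]_4) : Prop :=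
  vector_field xi /\
  forall i X Y, smooth_on (chart_img M i) X -> smooth_on (chart_img M i) Y ->
    forall y, chart_img M i y -> lie_metric (xi i) (g i) X Y y = 0.

(* The sign convention is immaterial since [h] may be replaced by [- h]. *)
Definition hamiltonian g J (xi : chart M -> 'rV[R]_4 -> 'rV[R]_4) : Prop :=
  exists2 h : M -> R, smooth_function h &
    forall i y v, chart_img M i y ->
      kahler_form (g i) (J i) y (xi i y) v = - 'D_v (h \o chart_inv M i) y.

Definition opposite_along g J (xi : chart M -> 'rV[R]_4 -> 'rV[R]_4)
    (I : chart M -> 'rV[R]_4 -> 'M[R]_4) : Prop :=
  forall i y, chart_img M i y ->
    let D := col_mx (xi i y) (xi i y *m J i y) in
    (forall v : 'rV[R]_4, (v <= D)%MS -> v *m I i y = v *m J i y) /\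
    (forall v, (forall w : 'rV[R]_4, (w <= D)%MS -> ip (g i y) v w = 0) ->
       v *m I i y = - (v *m J i y)).

Definition conformal (f : M -> R) g : chart M -> 'rV[R]_4 -> 'M[R]_4 :=
  fun i y => f (chart_inv M i y) ^+ 2 *: g i y.

Definition calabi_type g J : Prop :=
  kahler_surface g J /\
  exists xi : chart M -> 'rV[R]_4 -> 'rV[R]_4,
    [/\ killing g xi,
        hamiltonian g J xi,
        forall i y, chart_img M i y -> xi i y != 0
      & exists I : chart M -> 'rV[R]_4 -> 'M[R]_4,
          opposite_along g J xi I /\
          exists f : M -> R,
            [/\ smooth_function f, forall x, 0 < f x
              & kahler_surface (conformal f g) I]].

Definition orth_proj (G : 'M[R]_4) (D : set 'rV[R]_4) (u p : 'rV[R]_4) : Prop :=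
  D p /\ forall w, D w -> ip G (u - p) w = 0.

Definition hol_sect_curv (g J : 'rV[R]_4 -> 'M[R]_4) (y u : 'rV[R]_4) : R :=
  curv g y u (u *m J y) (u *m J y) u.

Definition qch g J : Prop :=
  [/\ connected [set: M],
      kahler_surface g J
    & exists D : chart M -> 'rV[R]_4 -> set 'rV[R]_4,
        [/\ smooth_distribution 2 D,
            forall i y v, chart_img M i y -> D i y v -> D i y (v *m J i y)
          & forall i y u v p q, chart_img M i y ->
              inorm (g i y) u = 1 -> inorm (g i y) v = 1 ->
              orth_proj (g i y) (D i y) u p -> orth_proj (g i y) (D i y) v q ->
              inorm (g i y) p = inorm (g i y) q ->
              hol_sect_curv (g i) (J i) y u = hol_sect_curv (g i) (J i) y v]].

End Kahler.

(* Main.v *)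
Require Import Defs.
From mathcomp Require Import all_boot all_order all_algebra.
From mathcomp Require Import all_classical all_reals all_analysis.
From mathcomp Require Import ring lra.
Import Order.TTheory GRing.Theory Num.Theory.
Import numFieldNormedType.Exports.

(** The distribution that works is the plane field [D] spanned by the Hamiltonian
    Killing field [xi] and [J xi].  Write [I] for the opposite structure, which is
    [J] on [D] and [- J] on its orthogonal complement [D'], and [phi = d log f] for
    the conformal factor [f].

    First order.  A metric and a structure that are Kähler make the structure
    parallel ([kahler_parallel]); applied to [f^2 g] and [I] this expresses the
    covariant derivative of [I] for [g] algebraically through [phi]
    ([cov_end_conformal]).  On the other hand [I xi = J xi], so differentiating
    this equality computes the composite of [J - I] with [A], the covariant
    derivative of [xi].  Now [A] is skew because [xi] is Killing and commutes with
    [J] because [xi] is Hamiltonian.  These constraints leave little room: [phi]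
    vanishes on [xi] and on [D'], and [A] maps [xi] to a multiple of [J xi] and is
    [phi (J xi) / 2] times [J] on [D'] ([phi_xi0], [phi_perp], [nabla_perp],
    [nabla_xi]).

    Second order.  The identity
    [R(u, w) xi = (nabla_u A) w - (nabla_w A) u] ([xi_riem]) gives the curvature
    components with an entry [xi].  Differentiating the first-order equalities
    shows that [R(xi, J xi, xi, z)] and [R(x, y, xi, z)] vanish and that
    [R(xi, z, xi, z)] is a constant times [|z|^2], for [x, y, z] in [D'].  The
    second of these needs [phi (J xi)] to be constant along [D']: [phi] and the
    differential of the Hamiltonian are exact and proportional, hence the
    differential of the factor of proportionality is controlled
    ([proportional_differentials], [dlog_xiJ_perp]).

    Conclusion.  The symmetries of a Kähler curvature tensor turn these components
    into [K (t xi + z) = t^4 K (xi) - 8 C t^2 |z|^2 + K (z)] for [z] in [D'], where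
    [K (u) = R(u, J u, J u, u)] ([hol_form_split]).  Since [K] is invariant under
    multiplication by complex numbers of modulus one, the component of a vector
    along [D] may be turned into a multiple of [xi]; and [D'], being a complex
    line, contributes a constant times [|z|^4].  So [K] depends only on the lengths
    of the two components ([hol_form_formula]).

    Vectors are rows, endomorphisms act on the right, and the Levi-Civita
    connection in a chart is a matrix [conn u y] with [v *m conn u y] the
    Christoffel term.  Covariant derivatives are taken in constant directions
    only, so that no brackets occur.  The calculus that is needed beyond product
    rules is that directional derivatives are linear in the direction and commute;
    smoothness here only provides iterated continuous directional derivatives, and
    both facts are drawn from the mean value theorem ([derive_linear],
    [derive_comm]). *)

Set Implicit Arguments.
Unset Strict Implicit.
Unset Printing Implicit Defensive.

Local Open Scope classical_set_scope.
Local Open Scope ring_scope.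

(** * Smooth functions on an open set *)

Section CkClosure.
Context {R : realType} {V W : normedModType R} (O : set V).
Hypothesis openO : open O.
Implicit Types f g : V -> W.

Lemma near_eq_open f g x : O x -> (forall y, O y -> f y = g y) ->
  \forall y \near x, f y = g y.
Proof.
move=> Ox fg; have : nbhs x O by apply: open_nbhs_nbhs; split.
by apply: filterS => y /fg.
Qed.

Lemma derive_eq_on f g x v : O x -> (forall y, O y -> f y = g y) ->
  'D_v f x = 'D_v g x.
Proof. by move=> Ox fg; apply: near_eq_derive; apply: near_eq_open. Qed.

(** Derivatives at a point of an open set only see the values on that set; every
    closure property below is proved by rewriting a derivative on [O] alone. *)
Lemma Ck_on_eq k f g : (forall y, O y -> f y = g y) ->
  Ck_on k O f -> Ck_on k O g.
Proof.
elim: k f g => [|k IH] f g fg /= [cf Hf]; split.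
- move=> x Ox; rewrite /prop_for /continuous_at -(fg x Ox).
  apply: cvg_trans (cf x Ox); apply: near_eq_cvg.
  by apply: near_eq_open => // y Oy; rewrite fg.
- by [].
- move=> x Ox; rewrite /prop_for /continuous_at -(fg x Ox).
  apply: cvg_trans (cf x Ox); apply: near_eq_cvg.
  by apply: near_eq_open => // y Oy; rewrite fg.
- move=> v; have [df Cf] := Hf v; split.
    move=> x Ox; apply: near_eq_derivable (df x Ox).
    exact: near_eq_open.
  by apply: IH Cf => y Oy; apply: derive_eq_on.
Qed.

Lemma Ck_on_pred k f : Ck_on k.+1 O f -> Ck_on k O f.
Proof.
elim: k f => [|k IH] f /= [cf Hf]; split => // v.
have [df Cf] := Hf v; split => //; exact: IH.
Qed.

Lemma Ck_on_cst k (a : W) : Ck_on k O (cst a).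
Proof.
elim: k a => [|k IH] a /=; split; try (by move=> x _; exact: cst_continuous).
- by [].
- move=> v; split; first by move=> x _; exact: derivable_cst.
  by apply: Ck_on_eq (IH 0) => y _; rewrite derive_cst.
Qed.

Lemma Ck_onD k f g : Ck_on k O f -> Ck_on k O g -> Ck_on k O (f + g).
Proof.
elim: k f g => [|k IH] f g /= [cf Hf] [cg Hg]; split;
  try (by move=> x Ox; apply: continuousD; [exact: cf|exact: cg]).
- by [].
- move=> v; have [df Cf] := Hf v; have [dg Cg] := Hg v; split.
    by move=> x Ox; apply: derivableD; [exact: df|exact: dg].
  apply: Ck_on_eq (IH _ _ Cf Cg) => y Oy.
  by rewrite deriveD; [|exact: df|exact: dg].
Qed.

Lemma smooth_eq f g : (forall y, O y -> f y = g y) ->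
  smooth_on O f -> smooth_on O g.
Proof. by move=> fg sf k; apply: Ck_on_eq (sf k). Qed.

Lemma smooth_cst (a : W) : smooth_on O (cst a).
Proof. by move=> k; exact: Ck_on_cst. Qed.

Lemma smoothD f g : smooth_on O f -> smooth_on O g -> smooth_on O (f + g).
Proof. by move=> sf sg k; exact: Ck_onD. Qed.

Lemma smooth_derive f v : smooth_on O f -> smooth_on O ('D_v f).
Proof. by move=> sf k; have [_ /(_ v)[]] := sf k.+1. Qed.

Lemma smooth_derivable f v x : smooth_on O f -> O x -> derivable f x v.
Proof. by move=> sf Ox; have [_ /(_ v)[+ _]] := sf 1%N; apply. Qed.

Lemma smooth_continuous f x : smooth_on O f -> O x -> {for x, continuous f}.
Proof. by move=> sf Ox; have [+ _] := sf 0%N; apply. Qed.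

End CkClosure.

(** The final estimate of [derive_linear], isolated so that it mentions no
    derivative. *)
Lemma norm_combination_le {R : realDomainType} (a b p q r e : R) :
  `|p| < e -> `|q| < e -> `|r| < e ->
  `|b * p + a * q - r| <= e * (1 + `|a| + `|b|).
Proof.
move=> /ltW pe /ltW qe /ltW re.
have bp : `|b * p| <= `|b| * e by rewrite normrM ler_wpM2l.
have aq : `|a * q| <= `|a| * e by rewrite normrM ler_wpM2l.
have := ler_normB (b * p + a * q) r; have := ler_normD (b * p) (a * q).
move: bp aq; move: `|a| `|b| `|b * p| `|a * q| => a' b' bp aq.
by rewrite !mulrDr mulr1 ![e * _]mulrC; lra.
Qed.

Section CkScalar.
Context {R : realType} {V : normedModType R} (O : set V).
Hypothesis openO : open O.
Implicit Types f g : V -> R.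

Lemma Ck_onM k f g : Ck_on k O f -> Ck_on k O g -> Ck_on k O (f * g).
Proof.
elim: k f g => [|k IH] f g; move=> Kf Kg; have [cf Hf] := Kf; have [cg Hg] := Kg;
  split; try (by move=> x Ox; apply: continuousM; [exact: cf|exact: cg]).
- by [].
- move=> v; have [df Cf] := Hf v; have [dg Cg] := Hg v; split.
    by move=> x Ox; apply: derivableM; [exact: df|exact: dg].
  apply: (@Ck_on_eq _ _ _ _ _ _ (f * 'D_v g + g * 'D_v f)) => //.
    by move=> y Oy; rewrite deriveM; [|exact: df|exact: dg].
  by apply: Ck_onD => //; apply: IH => //; apply: Ck_on_pred.
Qed.

Lemma Ck_onV k f : (forall x, O x -> f x != 0) -> Ck_on k O f ->
  Ck_on k O (fun y => (f y)^-1).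
Proof.
move=> f0; elim: k => [|k IH]; move=> Kf; have [cf Hf] := Kf;
  split; try (by move=> x Ox; apply: cvgV; [exact: f0|exact: cf]).
- by [].
- move=> v; have [df Cf] := Hf v; split.
    by move=> x Ox; apply: derivableV; [exact: f0|exact: df].
  have IHf := IH (Ck_on_pred Kf).
  apply: (@Ck_on_eq _ _ _ _ _ _
    (cst (-1) * ((fun y => (f y)^-1) * (fun y => (f y)^-1) * 'D_v f))) => //.
    move=> y Oy; rewrite deriveV; [|exact: f0|exact: df].
    rewrite -[RHS]/(- (f y) ^- 2 * 'D_v f y).
    rewrite -[LHS]/(-1 * ((f y)^-1 * (f y)^-1 * 'D_v f y)).
    by rewrite expr2 invfM; ring.
  apply: Ck_onM; first exact: Ck_on_cst.
  by apply: Ck_onM => //; apply: Ck_onM.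
Qed.

Lemma smoothM f g : smooth_on O f -> smooth_on O g -> smooth_on O (f * g).
Proof. by move=> sf sg k; exact: Ck_onM. Qed.

Lemma smoothV f : (forall x, O x -> f x != 0) -> smooth_on O f ->
  smooth_on O (fun y => (f y)^-1).
Proof. by move=> f0 sf k; exact: Ck_onV. Qed.

Lemma smoothN f : smooth_on O f -> smooth_on O (- f).
Proof.
move=> sf; apply: (@smooth_eq _ _ _ _ openO (cst (-1) * f)).
  by move=> y _; rewrite /GRing.mul/= mulN1r.
by apply: smoothM => //; exact: smooth_cst.
Qed.

Lemma smooth_sum (I : Type) (r : seq I) (F : I -> V -> R) :
  (forall i, smooth_on O (F i)) -> smooth_on O (fun y => \sum_(i <- r) F i y).
Proof.
move=> sF; elim: r => [|i r IH].
  apply: (@smooth_eq _ _ _ _ openO (cst 0)); last exact: smooth_cst.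
  by move=> y _; rewrite big_nil.
apply: (@smooth_eq _ _ _ _ openO (F i + (fun y => \sum_(i <- r) F i y))).
  by move=> y _; rewrite big_cons.
exact: smoothD.
Qed.

Lemma smooth_prod (I : Type) (r : seq I) (F : I -> V -> R) :
  (forall i, smooth_on O (F i)) -> smooth_on O (fun y => \prod_(i <- r) F i y).
Proof.
move=> sF; elim: r => [|i r IH].
  apply: (@smooth_eq _ _ _ _ openO (cst (1 : R))); last exact: smooth_cst.
  by move=> y _; rewrite big_nil.
apply: (@smooth_eq _ _ _ _ openO (F i * (fun y => \prod_(i <- r) F i y))).
  by move=> y _; rewrite big_cons.
exact: smoothM.
Qed.

Lemma mean_value_line f x v (s : R) : 0 < s ->
  (forall t, 0 <= t <= s -> derivable f (t *: v + x) v) ->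
  exists2 c, 0 <= c <= s & f (s *: v + x) - f x = s * 'D_v f (c *: v + x).
Proof.
move=> s0 df; pose h (t : R) := f (t *: v + x).
have rate (t : R) : (fun k : R => k^-1 *: ((h \o shift t) (k *: 1) - h t)) =
    (fun k => k^-1 *: ((f \o shift (t *: v + x)) (k *: v) - f (t *: v + x))).
  by apply/funext => k; rewrite /h /= addrA -scalerDl [k *: 1]mulr1.
have dh t : 0 <= t <= s -> is_derive t 1 h ('D_v f (t *: v + x)).
  move=> ts; apply: DeriveDef; first by rewrite /derivable rate; exact: df.
  by rewrite /derive rate.
have [|t||c] := @MVT_segment R h (fun t => 'D_v f (t *: v + x)) 0 s.
- exact: ltW.
- by rewrite in_itv /= => /andP[t0 ts]; apply: dh; rewrite !ltW.
- apply: derivable_within_continuous => t; rewrite in_itv /= => ts.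
  by have [] := dh t ts.
- by rewrite in_itv /= subr0 mulrC /h scale0r add0r => cs e; exists c.
Qed.

(** The version for steps of either sign is needed because the coefficients of a
    linear combination of directions may be negative. *)
Lemma mean_value_line_signed f x v (s : R) :
  (forall t, `|t| <= `|s| -> derivable f (t *: v + x) v) ->
  exists2 c, `|c| <= `|s| & f (s *: v + x) - f x = s * 'D_v f (c *: v + x).
Proof.
move=> df; have [s0|s0|<-] := ltgtP 0 s.
- have [|c /andP[c0 cs] e] := mean_value_line s0 (x := x) (f := f) (v := v).
    move=> t /andP[t0 ts]; apply: df.
    by rewrite !ger0_norm // ltW.
  by exists c => //; rewrite !ger0_norm // ltW.
- have Ns0 : 0 < - s by rewrite oppr_gt0.
  have E c : c *: v + (s *: v + x) = (c + s) *: v + x.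
    by rewrite addrA scalerDl.
  have [|c /andP[c0 cs] e] :=
    mean_value_line Ns0 (x := s *: v + x) (f := f) (v := v).
    move=> t /andP[t0 ts]; rewrite E; apply: df.
    by rewrite ler0_norm ?(ltr0_norm s0); lra.
  exists (c + s); first by rewrite ler0_norm ?(ltr0_norm s0); lra.
  by move: e; rewrite !E addNr scale0r add0r => e; rewrite -opprB e mulNr opprK.
- by exists 0 => //; rewrite scale0r add0r subrr mul0r.
Qed.

(** All intermediate points produced by two successive mean value arguments with
    steps of order [s] have this form, so one bound on [s] handles them all. *)
Lemma nbhs_span2 (P : set V) x u v (A : R) : nbhs x P ->
  exists2 d, 0 < d & forall s, 0 < s < d ->
    forall b c, `|b| <= A * s -> `|c| <= A * s -> P (c *: v + (b *: u + x)).
Proof.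
move=> /nbhs_normP[e /= e0 eP].
have A0 := normr_ge0 A.
set m := (`|A| + 1) * (`|u| + `|v| + 1).
have m0 : 0 < m by rewrite mulr_gt0 // ?ltr_wpDl // ?addr_ge0.
exists (e / m); first by rewrite divr_gt0.
move=> s /andP[s0 sd] b c bs cs; apply: eP => /=.
rewrite addrA [_ + x]addrC opprD addrA subrr sub0r normrN.
apply: le_lt_trans (ler_normD _ _) _; rewrite !normrZ.
have H (w : V) (a : R) : `|a| <= A * s -> `|a| * `|w| <= (`|A| + 1) * s * `|w|.
  move=> aA; apply: ler_wpM2r => //; apply: le_trans aA _.
  apply: ler_wpM2r; first exact: ltW.
  by rewrite (le_trans (ler_norm A)) // lerDl.
apply: le_lt_trans (lerD (H v c cs) (H u b bs)) _.
have sm : s * m < e by rewrite -ltr_pdivlMr.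
apply: le_lt_trans sm; rewrite /m.
have Au : 0 <= s * (`|A| + 1) by rewrite mulr_ge0 ?addr_ge0 // ltW.
nra.
Qed.

(** The increment of [f] along [a *: u + b *: v] is the sum of an increment along
    [u] and one along [v]; the mean value theorem turns each of the three
    increments into a derivative at a nearby point, and continuity of the
    derivatives brings these points back to [x]. *)
Lemma derive_linear f x u v (a b : R) : smooth_on O f -> O x ->
  'D_(a *: u + b *: v) f x = a * 'D_u f x + b * 'D_v f x.
Proof.
move=> sf Ox; set w := a *: u + b *: v.
have df z t : O z -> derivable f z t by move=> Oz; exact: smooth_derivable sf Oz.
have near_D z e : 0 < e -> nbhs x [set y | O y /\ `|'D_z f y - 'D_z f x| < e].
  move=> e0; apply: filterI; first by apply: open_nbhs_nbhs; split.
  have /cvgrPdist_lt/(_ _ e0) :=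
    smooth_continuous (smooth_derive z sf) Ox.
  by apply: filterS => y; rewrite distrC.

apply/eqP; rewrite -subr_eq0 -normr_le0; apply/ler_addgt0Pr => e0 e0_gt0; rewrite add0r.
(* [K * s] bounds the coefficients of both steps, and [e * K] the final error. *)
set K := 1 + `|a| + `|b|.
have K0 : 0 < K by rewrite ltr_wpDr // ltr_wpDr.
pose e := e0 / K; have e_gt0 : 0 < e by rewrite divr_gt0.
have eK : e * K = e0 by rewrite divfK // gt_eqF.
clearbody e.
have /(nbhs_span2 u v K)[d1 d1_gt0 N1] := near_D u e e_gt0.
have /(nbhs_span2 u v K)[d2 d2_gt0 N2] := near_D v e e_gt0.
have /(nbhs_span2 w 0 1)[d3 d3_gt0 N3] := near_D w e e_gt0.
pose s := Num.min d1 (Num.min d2 d3) / 2.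
have s_gt0 : 0 < s by rewrite divr_gt0 // !lt_min d1_gt0 d2_gt0.
have sm : s < Num.min d1 (Num.min d2 d3).
  by rewrite /s ltr_pdivrMr // mulr_natr mulr2n ltrDl !lt_min d1_gt0 d2_gt0.
clearbody s; move: (sm); rewrite !lt_min => /and3P[s1 s2 s3].
have sn : `|s| = s by rewrite gtr0_norm.
have aK : `|s * a| <= K * s.
  by rewrite normrM sn mulrC ler_pM2r // /K; have := normr_ge0 b; lra.
have bK : `|s * b| <= K * s.
  by rewrite normrM sn mulrC ler_pM2r // /K; have := normr_ge0 a; lra.
have [|c1 c1s E1] := @mean_value_line_signed f x u (s * a).
  move=> t ts; have [|||Oz _] := N1 s _ t 0.
  - by rewrite s_gt0.
  - exact: le_trans aK.
  - by rewrite normr0 mulr_ge0 // ltW.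
  - by move: Oz; rewrite scale0r add0r; exact: df.
have [|c2 c2s E2] := @mean_value_line_signed f ((s * a) *: u + x) v (s * b).
  move=> t ts; have [|||Oz _] := N2 s _ (s * a) t => //.
  - by rewrite s_gt0.
  - exact: le_trans bK.
  - exact: df.
have [|c3 c3s E3] := @mean_value_line_signed f x w s.
  move=> t ts; have [|||Oz _] := N3 s _ t 0.
  - by rewrite s_gt0.
  - by rewrite mul1r -sn.
  - by rewrite normr0 mulr_ge0 // ltW.
  - by move: Oz; rewrite scale0r add0r; exact: df.
have [|||_ H1] := N1 s _ c1 0.
- by rewrite s_gt0.
- exact: le_trans aK.
- by rewrite normr0 mulr_ge0 // ltW.
have [|||_ H2] := N2 s _ (s * a) c2 => //.
- by rewrite s_gt0.
- exact: le_trans bK.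
have [|||_ H3] := N3 s _ c3 0.
- by rewrite s_gt0.
- by rewrite mul1r -sn.
- by rewrite normr0 mulr_ge0 // ltW.
move: H1 H3; rewrite !scale0r !add0r => H1 H3.
have : s * 'D_w f (c3 *: w + x) =
   s * b * 'D_v f (c2 *: v + ((s * a) *: u + x)) + s * a * 'D_u f (c1 *: u + x).
  rewrite -E1 -E2 -E3 addrA subrK; congr (f _ - _).
  by rewrite /w scalerDr !scalerA addrA [_ + (s * a) *: u]addrC.
rewrite -!mulrA -mulrDr => EE.
have inj_s : forall p q : R, s * p = s * q -> p = q.
  exact: mulfI (lt0r_neq0 s_gt0).
have E := inj_s _ _ EE; move: E H1 H2 H3.
set X1 := 'D_u f (_ + x); set X2 := 'D_v f (_ + (_ + x)).
set X3 := 'D_w f (_ + x) => E H1 H2 H3.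
have -> : 'D_w f x - (a * 'D_u f x + b * 'D_v f x) =
  b * (X2 - 'D_v f x) + a * (X1 - 'D_u f x) - (X3 - 'D_w f x).
  by rewrite E; clear; move: X1 X2 ('D_w f x) ('D_u f x) ('D_v f x) => *; ring.
rewrite -eK; exact: norm_combination_le H2 H1 H3.
Qed.

Lemma derive_shift_on f a v x : 'D_v (fun z => f (a + z)) x = 'D_v f (a + x).
Proof.
rewrite /derive; set F := fun h : R => _; set G := fun h : R => _.
by have -> // : F = G; apply/funext => h; rewrite /F /G /= addrCA.
Qed.

Lemma derivable_shift_on f a v x :
  derivable f (a + x) v -> derivable (fun z => f (a + z)) x v.
Proof.
rewrite /derivable; set F := fun h : R => _; set G := fun h : R => _.
by have -> // : F = G; apply/funext => h; rewrite /F /G /= addrCA.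
Qed.

(** The second difference is symmetric in [u] and [v] whereas the right-hand side
    is not; this is what makes the derivatives commute. *)
Lemma second_difference f x u v (s : R) : 0 < s ->
  smooth_on O f ->
  (forall b c, `|b| <= s -> `|c| <= s -> O (c *: v + (b *: u + x))) ->
  exists b c, [/\ `|b| <= s, `|c| <= s &
    f (s *: v + (s *: u + x)) - f (s *: u + x) - f (s *: v + x) + f x =
    s * (s * 'D_v ('D_u f) (c *: v + (b *: u + x)))].
Proof.
move=> s0 sf HO; have sn : `|s| = s by rewrite gtr0_norm.
have df z t : O z -> derivable f z t by move=> Oz; exact: smooth_derivable sf Oz.
pose F z := f (s *: v + z) - f z.
have O1 t : `|t| <= s -> O (t *: u + x).
  move=> ts; have := HO t 0 ts; rewrite normr0 scale0r add0r; apply.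
  exact: ltW.
have dF t : `|t| <= s -> derivable (fun z => f (s *: v + z)) (t *: u + x) u.
  by move=> ts; apply/derivable_shift_on/df/HO => //; rewrite sn.
have [|b bs E1] := @mean_value_line_signed F x u s.
  rewrite sn => t ts; apply: derivableB; first exact: dF.
  by apply: df; exact: O1.
rewrite sn in bs.
have [|c cs E2] := @mean_value_line_signed ('D_u f) (b *: u + x) v s.
  rewrite sn => t ts; apply: smooth_derivable (smooth_derive u sf) _.
    exact: HO ts.
rewrite sn in cs.
exists b, c; split => //; rewrite -E2.
have -> : 'D_u f (s *: v + (b *: u + x)) - 'D_u f (b *: u + x) =
          'D_u F (b *: u + x).
  rewrite [RHS]deriveB ?derive_shift_on //; first exact: dF.
  by apply: df; exact: O1.
by rewrite -E1 /F; ring.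
Qed.

(** Both iterated derivatives, taken at suitable points close to [x], equal the same
    second difference divided by [s ^+ 2]. *)
Lemma derive_comm f x u v : smooth_on O f -> O x ->
  'D_v ('D_u f) x = 'D_u ('D_v f) x.
Proof.
move=> sf Ox.
have near_D a b e : 0 < e ->
    nbhs x [set y | O y /\ `|'D_a ('D_b f) y - 'D_a ('D_b f) x| < e].
  move=> e0; apply: filterI; first by apply: open_nbhs_nbhs; split.
  exact: cvgr_distC_lt (smooth_continuous (smooth_derive a (smooth_derive b sf)) Ox) _ e0.
apply/eqP; rewrite -subr_eq0 -normr_le0; apply/ler_addgt0Pr => e0 e0_gt0; rewrite add0r.
pose e := e0 / 2; have e_gt0 : 0 < e by rewrite divr_gt0.
have /(nbhs_span2 u v 1)[d1 d1_gt0 N1] := near_D v u e e_gt0.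
have /(nbhs_span2 v u 1)[d2 d2_gt0 N2] := near_D u v e e_gt0.
pose s := Num.min d1 d2 / 2.
have s_gt0 : 0 < s by rewrite divr_gt0 // lt_min d1_gt0 d2_gt0.
have sm : s < Num.min d1 d2.
  by rewrite /s ltr_pdivrMr // mulr_natr mulr2n ltrDl lt_min d1_gt0 d2_gt0.
clearbody s; move: (sm); rewrite !lt_min => /andP[s1 s2].
have [|b1 [c1 [b1s c1s E1]]] := second_difference s_gt0 sf (x:=x) (u:=u) (v:=v).
  move=> b c bs cs; have [|||//] := N1 s _ b c.
  - by rewrite s_gt0.
  - by rewrite mul1r.
  - by rewrite mul1r.
have [|b2 [c2 [b2s c2s E2]]] := second_difference s_gt0 sf (x:=x) (u:=v) (v:=u).
  move=> b c bs cs; have [|||//] := N2 s _ b c.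
  - by rewrite s_gt0.
  - by rewrite mul1r.
  - by rewrite mul1r.
have [|||_ H1] := N1 s _ b1 c1; rewrite ?mul1r ?s_gt0 //.
have [|||_ H2] := N2 s _ b2 c2; rewrite ?mul1r ?s_gt0 //.
have E : 'D_v ('D_u f) (c1 *: v + (b1 *: u + x)) =
         'D_u ('D_v f) (c2 *: u + (b2 *: v + x)).
  apply: (mulfI (lt0r_neq0 s_gt0)); apply: (mulfI (lt0r_neq0 s_gt0)).
  move: E2; rewrite [in f (_ + _)]addrCA => E2.
  exact: etrans (etrans (esym E1) (congr1 (+%R^~ (f x)) (addrAC _ _ _))) E2.
rewrite -(subrKA ('D_v ('D_u f) (c1 *: v + (b1 *: u + x)))) {2}E.
have -> : e0 = e + e by rewrite /e -splitr.
apply: le_trans (ler_normD _ _) _; apply: lerD; last exact: (ltW H2).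
by rewrite distrC; exact: (ltW H1).
Qed.
End CkScalar.

(** * Matrix-valued functions *)

Section SmoothMatrices.
Context {R : realType} {V : normedModType R} (O : set V).
Hypothesis openO : open O.

Lemma continuous_mxP m n (F : V -> 'M[R]_(m, n)) x :
  {for x, continuous F} <-> forall i j, {for x, continuous (fun y => F y i j)}.
Proof.
split=> [cF i j|cF].
  apply: (@continuous_comp _ _ _ F (fun M : 'M[R]_(m, n) => M i j)) => //.
  exact: coord_continuous.
apply/cvgrPdist_le => /= e e0; near=> y.
rewrite /Num.Def.normr/= mx_normrE (bigmax_le _ (ltW e0))//= => i _.
rewrite !mxE/=; move: i; near: y; apply: filter_forall => /= i.
exact: ((cvgrPdist_le _ _).1 (cF i.1 i.2)).
Unshelve. all: by end_near. Qed.

Lemma Ck_on_mxP k m n (F : V -> 'M[R]_(m, n)) :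
  Ck_on k O F <-> forall i j, Ck_on k O (fun y => F y i j).
Proof.
elim: k F => [|k IH] F; split.
- by move=> [cF _] i j; split => // x Ox; move/continuous_mxP: (cF x Ox).
- by move=> H; split => // x Ox; apply/continuous_mxP => i j; have [+ _] := H i j; apply.
- move=> [cF HF] i j; split.
    by move=> x Ox; move/continuous_mxP: (cF x Ox).
  move=> v; have [dF /IH/(_ i j) Cf] := HF v; split.
    by move=> x Ox; move/derivable_mxP: (dF x Ox).
  apply: Ck_on_eq Cf => // y Oy.
  by rewrite derive_mx ?mxE //; exact: dF.
- move=> H; split.
    by move=> x Ox; apply/continuous_mxP => i j; have [+ _] := H i j; apply.
  move=> v; have dF x : O x -> derivable F x v.
    move=> Ox; apply/derivable_mxP => i j.
    by have [_ /(_ v)[+ _]] := H i j; apply.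
  split => //; apply/IH => i j; have [_ /(_ v)[_ Cf]] := H i j.
  apply: Ck_on_eq Cf => // y Oy.
  by rewrite derive_mx ?mxE //; exact: dF.
Qed.

(** Reduces every closure property of matrix-valued functions to real-valued ones. *)
Lemma smooth_mxP m n (F : V -> 'M[R]_(m, n)) :
  smooth_on O F <-> forall i j, smooth_on O (fun y => F y i j).
Proof.
split=> [sF i j k|sF k]; last by apply/Ck_on_mxP => i j; exact: sF.
by have /Ck_on_mxP := sF k; apply.
Qed.

Lemma smooth_mx_fun m n (F : 'I_m -> 'I_n -> V -> R) :
  (forall i j, smooth_on O (F i j)) ->
  smooth_on O (fun y => \matrix_(i, j) F i j y).
Proof.
move=> sF; apply/smooth_mxP => i j; apply: smooth_eq (sF i j) => // y _.
by rewrite mxE.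
Qed.

Lemma smooth_mulmx m n p (F : V -> 'M[R]_(m, n)) (G : V -> 'M[R]_(n, p)) :
  smooth_on O F -> smooth_on O G -> smooth_on O (fun y => F y *m G y).
Proof.
move=> /smooth_mxP sF /smooth_mxP sG; apply/smooth_mxP => i j.
have := @smooth_sum _ _ _ openO _ (index_enum 'I_n)
  (fun k y => F y i k * G y k j) (fun k => smoothM openO (sF i k) (sG k j)).
by apply: smooth_eq => // y _; rewrite mxE.
Qed.

Lemma smooth_trmx m n (F : V -> 'M[R]_(m, n)) :
  smooth_on O F -> smooth_on O (fun y => (F y)^T).
Proof.
move=> /smooth_mxP sF; apply/smooth_mxP => i j.
by apply: smooth_eq (sF j i) => // y _; rewrite mxE.
Qed.

Lemma smooth_col_mx m p n (F : V -> 'M[R]_(m, n)) (G : V -> 'M[R]_(p, n)) :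
  smooth_on O F -> smooth_on O G -> smooth_on O (fun y => col_mx (F y) (G y)).
Proof.
move=> /smooth_mxP sF /smooth_mxP sG; apply/smooth_mxP => i j.
case: (split_ordP i) => k ->.
  by apply: smooth_eq (sF k j) => // y _; rewrite col_mxEu.
by apply: smooth_eq (sG k j) => // y _; rewrite col_mxEd.
Qed.

Lemma smooth_scalemx m n (f : V -> R) (F : V -> 'M[R]_(m, n)) :
  smooth_on O f -> smooth_on O F -> smooth_on O (fun y => f y *: F y).
Proof.
move=> sf /smooth_mxP sF; apply/smooth_mxP => i j.
by apply: smooth_eq (smoothM openO sf (sF i j)) => // y _; rewrite mxE.
Qed.

Lemma smooth_addmx m n (F G : V -> 'M[R]_(m, n)) :
  smooth_on O F -> smooth_on O G -> smooth_on O (fun y => F y + G y).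
Proof. exact: smoothD. Qed.

Lemma smooth_oppmx m n (F : V -> 'M[R]_(m, n)) :
  smooth_on O F -> smooth_on O (fun y => - F y).
Proof.
move=> /smooth_mxP sF; apply/smooth_mxP => i j.
by apply: smooth_eq (smoothN openO (sF i j)) => // y _; rewrite mxE.
Qed.

Lemma smooth_det n (F : V -> 'M[R]_n) :
  smooth_on O F -> smooth_on O (fun y => \det (F y)).
Proof.
move=> /smooth_mxP sF; apply: smooth_sum => // s.
apply: (smoothM openO (f := cst _)); first exact: smooth_cst.
by apply: smooth_prod => // i; exact: sF.
Qed.

(** By the formula of Cramer, the entries of the inverse are polynomials in the
    entries divided by the determinant. *)
Lemma smooth_invmx n (F : V -> 'M[R]_n) :
  (forall y, O y -> F y \in unitmx) ->
  smooth_on O F -> smooth_on O (fun y => invmx (F y)).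
Proof.
move=> uF sF.
have sadj : smooth_on O (fun y => \adj (F y)).
  apply/smooth_mxP => i j.
  have : smooth_on O (fun y => cofactor (F y) j i).
    apply: (smoothM openO (f := cst _)); first exact: smooth_cst.
    apply: smooth_det; apply/smooth_mxP => k l.
    move/smooth_mxP: sF => /(_ (lift j k) (lift i l)).
    by apply: smooth_eq => // y _; rewrite !mxE.
  by apply: smooth_eq => // y _; rewrite mxE.
have sdet : smooth_on O (fun y => (\det (F y))^-1).
  apply: smoothV => //; last exact: smooth_det.
  by move=> y /uF; rewrite unitmxE unitfE.
apply: smooth_eq (smooth_scalemx sdet sadj) => // y Oy.
by rewrite /invmx uF.
Qed.

Lemma derive_mxE m n (F : V -> 'M[R]_(m, n)) v y i j :
  smooth_on O F -> O y -> ('D_v F y) i j = 'D_v (fun z => F z i j) y.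
Proof.
by move=> sF Oy; rewrite derive_mx ?mxE //; exact: smooth_derivable sF Oy.
Qed.

Lemma derive_mulmx m n p (F : V -> 'M[R]_(m, n)) (G : V -> 'M[R]_(n, p)) v y :
  smooth_on O F -> smooth_on O G -> O y ->
  'D_v (fun z => F z *m G z) y = 'D_v F y *m G y + F y *m 'D_v G y.
Proof.
move=> sF sG Oy; apply/matrixP => i j.
rewrite (derive_mxE _ _ _ (smooth_mulmx sF sG) Oy) !mxE -big_split /=.
have dF k : derivable (fun z => F z i k) y v.
  by move/smooth_mxP: sF => /(_ i k) sFk; exact: smooth_derivable sFk Oy.
have dG k : derivable (fun z => G z k j) y v.
  by move/smooth_mxP: sG => /(_ k j) sGk; exact: smooth_derivable sGk Oy.
have -> : (fun z => (F z *m G z) i j) =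
    \sum_(k < n) (fun z => F z i k) * (fun z => G z k j).
  by apply/funext => z; rewrite mxE fct_sumE.
rewrite derive_sum; last by move=> k; apply: derivableM.
apply: eq_bigr => k _.
rewrite (derive_mxE _ i k sF) // (derive_mxE _ k j sG) //.
apply: etrans (deriveM (dF k) (dG k)) _; rewrite addrC; congr (_ + _).
exact: mulrC.
Qed.

Lemma derive_trmx m n (F : V -> 'M[R]_(m, n)) v y :
  smooth_on O F -> O y -> 'D_v (fun z => (F z)^T) y = ('D_v F y)^T.
Proof.
move=> sF Oy; apply/matrixP => i j.
rewrite (derive_mxE _ _ _ (smooth_trmx sF) Oy) mxE (derive_mxE _ _ _ sF) //.
by apply: (derive_eq_on openO _ Oy) => z _; rewrite mxE.
Qed.

Lemma derive_scalemx m n (f : V -> R) (F : V -> 'M[R]_(m, n)) v y :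
  smooth_on O f -> smooth_on O F -> O y ->
  'D_v (fun z => f z *: F z) y = 'D_v f y *: F y + f y *: 'D_v F y.
Proof.
move=> sf sF Oy; apply/matrixP => i j.
rewrite (derive_mxE _ _ _ (smooth_scalemx sf sF) Oy) !mxE.
have E : 'D_v (fun z => (f z *: F z) i j) y = 'D_v (f * (fun z => F z i j)) y.
  by apply: (derive_eq_on openO _ Oy) => z _; rewrite mxE.
have dF : derivable (fun z => F z i j) y v.
  by move/smooth_mxP: sF => /(_ i j) sFk; exact: smooth_derivable sFk Oy.
have df : derivable f y v by exact: smooth_derivable sf Oy.
rewrite (derive_mxE _ _ _ sF) //.
apply: etrans E (etrans (deriveM df dF) _).
by rewrite addrC; congr (_ + _); exact: mulrC.
Qed.

Lemma derive_addmx m n (F G : V -> 'M[R]_(m, n)) v y :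
  smooth_on O F -> smooth_on O G -> O y ->
  'D_v (fun z => F z + G z) y = 'D_v F y + 'D_v G y.
Proof.
move=> sF sG Oy; apply: deriveD; [exact: smooth_derivable sF Oy|].
exact: smooth_derivable sG Oy.
Qed.

Lemma derive_oppmx m n (F : V -> 'M[R]_(m, n)) v y :
  smooth_on O F -> O y -> 'D_v (fun z => - F z) y = - 'D_v F y.
Proof. by move=> sF Oy; apply: deriveN; exact: smooth_derivable sF Oy. Qed.

Lemma derive_cstmx m n (C : 'M[R]_(m, n)) (v y : V) :
  'D_v (fun=> C) y = 0.
Proof. exact: derive_cst. Qed.

Lemma derive_mx_linear m n (F : V -> 'M[R]_(m, n)) y u v (a b : R) :
  smooth_on O F -> O y ->
  'D_(a *: u + b *: v) F y = a *: 'D_u F y + b *: 'D_v F y.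
Proof.
move=> sF Oy; apply/matrixP => i j.
have sFij : smooth_on O (fun z => F z i j) by move/smooth_mxP: sF.
have D w := derive_mxE w i j sF Oy.
have E := derive_linear openO u v a b sFij Oy.
apply: etrans (D _) (etrans E _).
rewrite [RHS]mxE [X in _ = X + _]mxE [X in _ = _ + X]mxE.
by congr (_ * _ + _ * _); apply/esym; exact: D.
Qed.

Lemma derive_mx_comm m n (F : V -> 'M[R]_(m, n)) y u v :
  smooth_on O F -> O y -> 'D_u ('D_v F) y = 'D_v ('D_u F) y.
Proof.
move=> sF Oy; apply/matrixP => i j.
have sFij : smooth_on O (fun z => F z i j) by move/smooth_mxP: sF.
have D a b : ('D_a ('D_b F) y) i j = 'D_a ('D_b (fun z => F z i j)) y.
  rewrite (derive_mxE _ _ _ (smooth_derive b sF)) //.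
  by apply: (derive_eq_on openO _ Oy) => z Oz; rewrite (derive_mxE _ _ _ sF).
have E := derive_comm openO v u sFij Oy.
have E1 := D u v.
have E2 := D v u.
exact: etrans E1 (etrans E (esym E2)).
Qed.

End SmoothMatrices.

(** * The bilinear form of a matrix *)

Section IpTheory.
Context {R : realType} {n : nat}.
Implicit Types (G A B : 'M[R]_n) (u v w z : 'rV[R]_n) (c : R).

Lemma ipDl G u v w : ip G (u + v) w = ip G u w + ip G v w.
Proof. by rewrite /ip !mulmxDl mxE. Qed.
Lemma ipDr G u v w : ip G u (v + w) = ip G u v + ip G u w.
Proof. by rewrite /ip linearD /= mulmxDr mxE. Qed.
Lemma ipZl G c u v : ip G (c *: u) v = c * ip G u v.
Proof. by rewrite /ip -!scalemxAl mxE. Qed.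
Lemma ipZr G c u v : ip G u (c *: v) = c * ip G u v.
Proof. by rewrite /ip linearZ /= -scalemxAr mxE. Qed.
Lemma ipNl G u v : ip G (- u) v = - ip G u v.
Proof. by rewrite /ip !mulNmx mxE. Qed.
Lemma ipNr G u v : ip G u (- v) = - ip G u v.
Proof. by rewrite /ip linearN /= mulmxN mxE. Qed.
Lemma ipBl G u v w : ip G (u - v) w = ip G u w - ip G v w.
Proof. by rewrite ipDl ipNl. Qed.
Lemma ipBr G u v w : ip G u (v - w) = ip G u v - ip G u w.
Proof. by rewrite ipDr ipNr. Qed.
Lemma ip0l G v : ip G 0 v = 0.
Proof. by rewrite /ip !mul0mx mxE. Qed.
Lemma ip0r G v : ip G v 0 = 0.
Proof. by rewrite /ip linear0 mulmx0 mxE. Qed.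

Lemma ip_mxD A B u v : ip (A + B) u v = ip A u v + ip B u v.
Proof. by rewrite /ip mulmxDr mulmxDl mxE. Qed.
Lemma ip_mxN A u v : ip (- A) u v = - ip A u v.
Proof. by rewrite /ip mulmxN mulNmx mxE. Qed.
Lemma ip_mxZ c A u v : ip (c *: A) u v = c * ip A u v.
Proof. by rewrite /ip -scalemxAr -scalemxAl mxE. Qed.
Lemma ip_tr A u v : ip A^T u v = ip A v u.
Proof.
rewrite /ip; have <- : (v *m A *m u^T)^T = u *m A^T *m v^T.
  by rewrite !trmx_mul trmxK mulmxA.
by rewrite mxE.
Qed.
Lemma ip_mull A G u v : ip (A *m G) u v = ip G (u *m A) v.
Proof. by rewrite /ip mulmxA. Qed.

Lemma ip_inj A B : (forall u v, ip A u v = ip B u v) -> A = B.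
Proof.
move=> AB; apply/matrixP => i j.
have := AB (delta_mx 0 i) (delta_mx 0 j).
by rewrite /ip !trmx_delta -!rowE -!colE !mxE.
Qed.

End IpTheory.

Section Metric.
Context {R : realType} {n : nat} (G : 'M[R]_n).
Hypothesis symG : G^T = G.
Hypothesis posG : forall v, v != 0 -> 0 < ip G v v.
Implicit Types (A B : 'M[R]_n) (u v w z : 'rV[R]_n) (c : R).

Lemma ipC u v : ip G u v = ip G v u.
Proof. by rewrite -[in LHS]symG ip_tr. Qed.

Lemma ip_eq0 u : ip G u u = 0 -> u = 0.
Proof.
by move=> uu0; apply/eqP; apply: contraT => /posG; rewrite uu0 ltxx.
Qed.

Lemma ip_ge0 u : 0 <= ip G u u.
Proof.
have [->|/posG/ltW//] := eqVneq u 0; by rewrite ip0l.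
Qed.

Lemma ip_nondeg u : (forall z, ip G u z = 0) -> u = 0.
Proof. by move=> H; apply: ip_eq0; exact: H. Qed.

Lemma ip_extl u v : (forall z, ip G u z = ip G v z) -> u = v.
Proof.
move=> H; apply/eqP; rewrite -subr_eq0; apply/eqP/ip_nondeg => z.
by rewrite ipBl H subrr.
Qed.

Lemma metric_unit : G \in unitmx.
Proof.
rewrite -row_free_unit -kermx_eq0; apply/eqP/row_matrixP => i.
rewrite row0; apply: ip_nondeg => z.
have : row i (kermx G) *m G = 0 by apply/sub_kermxP; exact: row_sub.
by rewrite /ip => ->; rewrite mul0mx mxE.
Qed.

End Metric.

(** * The Levi-Civita connection in a chart *)

Section Directions.
Context {R : realType} {n : nat} (O : set 'rV[R]_n).
Hypothesis openO : open O.
Local Notation vec := 'rV[R]_n.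

(** Makes the dependence on the direction explicit, which is what allows the
    direction to vary with the base point. *)
Lemma derive_mx_coord m p (F : vec -> 'M[R]_(m, p)) (v y : vec) :
  smooth_on O F -> O y ->
  'D_v F y = \sum_k v 0 k *: 'D_(delta_mx 0 k) F y.
Proof.
move=> sF Oy; rewrite [in LHS](row_sum_delta v).
elim/big_rec2: _ => [|k x z _ <-]; first exact: derive0.
by rewrite -[z in LHS]scale1r (derive_mx_linear openO _ _ _ _ sF Oy) scale1r.
Qed.

Lemma smooth_ip (F : vec -> 'M[R]_n) (X Y : vec -> vec) :
  smooth_on O F -> smooth_on O X -> smooth_on O Y ->
  smooth_on O (fun q => ip (F q) (X q) (Y q)).
Proof.
move=> sF sX sY.
have s := smooth_mulmx openO (smooth_mulmx openO sX sF) (smooth_trmx openO sY).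
by move/(smooth_mxP openO): s; apply.
Qed.

Lemma derive_ip (F : vec -> 'M[R]_n) (X Y : vec -> vec) (u y : vec) :
  smooth_on O F -> smooth_on O X -> smooth_on O Y -> O y ->
  'D_u (fun q => ip (F q) (X q) (Y q)) y =
  ip ('D_u F y) (X y) (Y y) + ip (F y) ('D_u X y) (Y y)
  + ip (F y) (X y) ('D_u Y y).
Proof.
move=> sF sX sY Oy.
have sXF := smooth_mulmx openO sX sF; have sYT := smooth_trmx openO sY.
have s := smooth_mulmx openO sXF sYT.
rewrite /ip -(derive_mxE u 0 0 s Oy).
rewrite (derive_mulmx openO u sXF sYT Oy) (derive_mulmx openO u sX sF Oy).
rewrite (derive_trmx openO u sY Oy).
move: ('D_u X y) ('D_u F y) ('D_u Y y) => X' F' Y'.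
by rewrite !mulmxDl !mxE; ring.
Qed.

End Directions.

(** The arithmetic of the Koszul formula, stated on real numbers so that it is
    checked without derivatives as atoms; likewise for the next two lemmas. *)
Lemma koszul_metric {R : realFieldType} (a a' b c p q : R) :
  2 * p = a + b - c -> 2 * q = a' + c - b -> a = a' -> a = p + q.
Proof. lra. Qed.

Lemma koszul_torsion {R : realFieldType} (a b c c' p q : R) :
  2 * p = a + b - c -> 2 * q = b + a - c' -> c = c' -> q = p.
Proof. lra. Qed.

Lemma cross_terms_cancel {R : realFieldType} (a b c d a' d' : R) :
  a + b + (c + d) = a' + c + (b + d') -> a' - a = - (d' - d).
Proof. lra. Qed.

Section LeviCivita.
Context {R : realType} {n : nat} (O : set 'rV[R]_n).
Hypothesis openO : open O.
Local Notation vec := 'rV[R]_n.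
Variable G : vec -> 'M[R]_n.
Hypothesis smoothG : smooth_on O G.
Hypothesis symG : forall y, O y -> (G y)^T = G y.
Hypothesis posG : forall y v, O y -> v != 0 -> 0 < ip (G y) v v.

(** The part of the Christoffel symbols in which the metric is differentiated along
    the vector that the connection acts on; see [half_connE]. *)
Definition half_conn (u : vec) (y : vec) : 'M[R]_n :=
  \matrix_(k, c) (u *m 'D_(delta_mx 0 k) G y) 0 c.

(** The connection in direction [u], as an endomorphism acting on rows; see
    [christoffelE].  Unlike [christoffel] it is manifestly linear in the vector
    acted on. *)
Definition conn (u : vec) (y : vec) : 'M[R]_n :=
  2^-1 *: ('D_u G y + half_conn u y - (half_conn u y)^T) *m invmx (G y).

Let unitG y : O y -> G y \in unitmx.
Proof.
by move=> Oy; apply: metric_unit => v; apply: posG.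
Qed.

Lemma smooth_half_conn u : smooth_on O (half_conn u).
Proof.
apply: smooth_mx_fun => // k c.
have s := smooth_mulmx openO (smooth_cst openO u)
  (smooth_derive (delta_mx 0 k : vec) smoothG).
by move/(smooth_mxP openO): s; apply.
Qed.

Lemma smooth_conn u : smooth_on O (conn u).
Proof.
apply: smooth_mulmx => //; last exact: smooth_invmx.
apply: (smooth_scalemx openO (f := cst _)); first exact: smooth_cst.
have sH := smooth_half_conn u.
apply: smooth_addmx => //.
  by apply: smooth_addmx => //; exact: smooth_derive.
by apply: smooth_oppmx => //; exact: smooth_trmx.
Qed.

Lemma half_connE u v y : O y -> v *m half_conn u y = u *m 'D_v G y.
Proof.
move=> Oy; rewrite (derive_mx_coord openO v smoothG Oy) mulmx_sumr.
apply/rowP => c; rewrite mxE summxE; apply: eq_bigr => k _.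
by rewrite -scalemxAr [RHS]mxE [in LHS]mxE.
Qed.

Lemma derive_metric_sym u y : O y -> ('D_u G y)^T = 'D_u G y.
Proof.
move=> Oy; apply: etrans (esym (derive_trmx openO u smoothG Oy)) _.
exact: (derive_eq_on openO _ Oy symG).
Qed.

Lemma koszul u v w y : O y ->
  2 * ip (G y) (v *m conn u y) w =
  ip ('D_u G y) v w + ip ('D_v G y) u w - ip ('D_w G y) u v.
Proof.
move=> Oy; rewrite -ip_mull /conn mulmxKV; last exact: unitG.
rewrite ip_mxZ mulrA divff // mul1r !ip_mxD ip_mxN ip_tr.
rewrite [ip (half_conn u y) v w]/ip [ip (half_conn u y) w v]/ip.
by rewrite !half_connE.
Qed.

(** Compatibility with the metric, for fields of constant components. *)
Lemma conn_metric u v w y : O y ->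
  ip ('D_u G y) v w = ip (G y) (v *m conn u y) w + ip (G y) v (w *m conn u y).
Proof.
move=> Oy; have k1 := koszul u v w Oy; have k2 := koszul u w v Oy.
have sym a b c : ip ('D_a G y) b c = ip ('D_a G y) c b.
  by rewrite -[in LHS](derive_metric_sym a Oy) ip_tr.
rewrite [ip (G y) v _](ipC (symG Oy)).
exact: koszul_metric k1 k2 (sym u v w).
Qed.

(** The connection is free of torsion, for fields of constant components. *)
Lemma conn_sym u v y : O y -> u *m conn v y = v *m conn u y.
Proof.
move=> Oy; apply: (@ip_extl _ _ (G y)) => [w|z]; first exact: posG.
have k1 := koszul u v z Oy; have k2 := koszul v u z Oy.
have sym a b c : ip ('D_a G y) b c = ip ('D_a G y) c b.
  by rewrite -[in LHS](derive_metric_sym a Oy) ip_tr.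
exact: koszul_torsion k1 k2 (sym z u v).
Qed.

(** By absence of torsion, linearity in the direction follows from linearity in
    the argument. *)
Lemma conn_linear a b u v y : O y ->
  conn (a *: u + b *: v) y = a *: conn u y + b *: conn v y.
Proof.
move=> Oy; apply/row_matrixP => i; rewrite !rowE.
rewrite conn_sym // mulmxDl -!scalemxAl mulmxDr -!scalemxAr.
by rewrite (conn_sym u _ Oy) (conn_sym v _ Oy).
Qed.

Lemma christoffelE u v y : O y -> christoffel G y u v = v *m conn u y.
Proof.
move=> Oy; rewrite /christoffel /conn mulmxA; congr (_ *m _).
rewrite -scalemxAr; congr (_ *: _); apply/rowP => c.
have D a b d : 'D_a (fun q => ip (G q) b d) y = ip ('D_a G y) b d.
  have := derive_ip openO a smoothG (smooth_cst openO b) (smooth_cst openO d) Oy.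
  by rewrite !derive_cst ip0l ip0r !addr0.
rewrite mxE !D !mulmxDr mulmxN.
rewrite half_connE // mxE [X in _ = X + _]mxE [X in _ = _ + X]mxE.
congr (_ + _ - _).
- by rewrite /ip trmx_delta -colE mxE.
- by rewrite /ip trmx_delta -colE mxE.
- rewrite /ip !mxE; apply: eq_bigr => k _.
  by rewrite mulrC !mxE; congr (_ * _).
Qed.

Section Covariant.
Variables (u y : vec).
Hypothesis Oy : O y.

Definition cov m (v : vec) (X : vec -> 'M[R]_(m, n)) (q : vec) : 'M[R]_(m, n) :=
  'D_v X q + X q *m conn v q.

(** The covariant derivative of an endomorphism field, determined by the product
    rule [cov_mulmx]. *)
Definition cov_end (v : vec) (A : vec -> 'M[R]_n) (q : vec) : 'M[R]_n :=
  'D_v A q + A q *m conn v q - conn v q *m A q.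

Lemma cov_cst m (C : 'M[R]_(m, n)) (v q : vec) :
  cov v (fun=> C) q = C *m conn v q.
Proof. by rewrite /cov derive_cstmx add0r. Qed.

Lemma smooth_cov m v (X : vec -> 'M[R]_(m, n)) :
  smooth_on O X -> smooth_on O (cov v X).
Proof.
move=> sX; apply: smooth_addmx => //; first exact: smooth_derive.
by apply: smooth_mulmx => //; exact: smooth_conn.
Qed.

Lemma cov_eq m (X Y : vec -> 'M[R]_(m, n)) :
  (forall q, O q -> X q = Y q) -> cov u X y = cov u Y y.
Proof.
by move=> XY; rewrite /cov (XY _ Oy) (derive_eq_on openO u Oy XY).
Qed.

Lemma cov_end_eq (A B : vec -> 'M[R]_n) :
  (forall q, O q -> A q = B q) -> cov_end u A y = cov_end u B y.
Proof.
by move=> AB; rewrite /cov_end (AB _ Oy) (derive_eq_on openO u Oy AB).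
Qed.

Lemma cov_mulmx m (X : vec -> 'M[R]_(m, n)) (A : vec -> 'M[R]_n) :
  smooth_on O X -> smooth_on O A ->
  cov u (fun q => X q *m A q) y = cov u X y *m A y + X y *m cov_end u A y.
Proof.
move=> sX sA; rewrite /cov /cov_end (derive_mulmx openO u sX sA Oy).
move: ('D_u X y) ('D_u A y) => X' A'.
rewrite !(mulmxBr, mulmxDl, mulmxDr) !mulmxA.
move: (X' *m A y) (X y *m A') (X y *m A y *m conn u y)
  (X y *m conn u y *m A y) => a b c d.
by apply/matrixP => i j; rewrite !mxE; ring.
Qed.

Lemma cov_end_mulmx (A B : vec -> 'M[R]_n) :
  smooth_on O A -> smooth_on O B ->
  cov_end u (fun q => A q *m B q) y = cov_end u A y *m B y + A y *m cov_end u B y.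
Proof.
move=> sA sB; rewrite /cov_end (derive_mulmx openO u sA sB Oy).
move: ('D_u A y) ('D_u B y) => A' B'.
rewrite !(mulmxBr, mulmxBl, mulmxDl, mulmxDr) !mulmxA.
move: (A' *m B y) (A y *m B') (A y *m B y *m conn u y) (conn u y *m A y *m B y)
  (A y *m conn u y *m B y) => a b c d e.
by apply/matrixP => i j; rewrite !mxE; ring.
Qed.

Lemma cov_end_scale (f : vec -> R) (A : vec -> 'M[R]_n) :
  smooth_on O f -> smooth_on O A ->
  cov_end u (fun q => f q *: A q) y = 'D_u f y *: A y + f y *: cov_end u A y.
Proof.
move=> sf sA; rewrite /cov_end (derive_scalemx openO u sf sA Oy).
by rewrite scalerBr scalerDr -scalemxAl -scalemxAr !addrA.
Qed.

Lemma cov_end_sub (A B : vec -> 'M[R]_n) :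
  smooth_on O A -> smooth_on O B ->
  cov_end u (fun q => A q - B q) y = cov_end u A y - cov_end u B y.
Proof.
move=> sA sB; have sN := smooth_oppmx openO sB.
rewrite /cov_end (derive_addmx u sA sN Oy) (derive_oppmx u sB Oy).
move: ('D_u A y) ('D_u B y) => A' B'.
rewrite mulmxBl mulmxBr.
move: (A y *m conn u y) (B y *m _) (conn u y *m A y) (_ *m B y) => a b c d.
by apply/matrixP => i j; rewrite !mxE; ring.
Qed.

Lemma derive_ip_cov (X Y : vec -> vec) :
  smooth_on O X -> smooth_on O Y ->
  'D_u (fun q => ip (G q) (X q) (Y q)) y =
  ip (G y) (cov u X y) (Y y) + ip (G y) (X y) (cov u Y y).
Proof.
move=> sX sY; rewrite (derive_ip openO u smoothG sX sY Oy) conn_metric //.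
rewrite /cov; move: ('D_u X y) ('D_u Y y) => X' Y'.
by rewrite !(ipDl, ipDr); ring.
Qed.

(** The metric is parallel, hence so is the condition of being skew. *)
Lemma cov_end_skew (A : vec -> 'M[R]_n) : smooth_on O A ->
  (forall q v w, O q -> ip (G q) (v *m A q) w = - ip (G q) v (w *m A q)) ->
  forall v w, ip (G y) (v *m cov_end u A y) w = - ip (G y) v (w *m cov_end u A y).
Proof.
move=> sA skA v w.
have sc (a : vec) : smooth_on O (fun _ : vec => a) := smooth_cst openO a.
have sm a : smooth_on O (fun q => a *m A q) := smooth_mulmx openO (sc a) sA.
have E : 'D_u (fun q => ip (G q) (v *m A q) w) y =
         'D_u (- (fun q => ip (G q) v (w *m A q))) y.
  by apply: (derive_eq_on openO _ Oy) => q Oq; exact: skA.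
move: E; rewrite deriveN; last first.
  exact: smooth_derivable (smooth_ip openO smoothG (sc v) (sm w)) Oy.
rewrite (derive_ip_cov (sm v) (sc w)) (derive_ip_cov (sc v) (sm w)).
rewrite !(cov_mulmx (sc _) sA) !cov_cst.
move: (cov_end u A y) => A'.
rewrite !(ipDl, ipDr) (skA y (v *m conn u y) w Oy) (skA y v (w *m conn u y) Oy).
by move=> E; lra.
Qed.

End Covariant.

(** The commutator of covariant derivatives in constant directions; the term with
    the bracket of the directions vanishes. *)
Definition riem (u v y : vec) : 'M[R]_n :=
  'D_u (conn v) y - 'D_v (conn u) y + conn v y *m conn u y
  - conn u y *m conn v y.

Lemma riem_antisym u v y : riem u v y = - riem v u y.
Proof.
rewrite /riem; move: ('D_u _ y) ('D_v _ y) (_ *m conn v y) (_ *m conn u y) => *.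
by apply/matrixP => i j; rewrite !mxE; ring.
Qed.

Lemma riem_linear a b u w v y : O y ->
  riem (a *: u + b *: w) v y = a *: riem u v y + b *: riem w v y.
Proof.
move=> Oy; rewrite /riem (derive_mx_linear openO u w a b (smooth_conn v) Oy).
have sZ c x : smooth_on O (fun q => c *: conn x q).
  by apply: (smooth_scalemx openO (f := cst c)) => //; [exact: smooth_cst|exact: smooth_conn].
have dZ c x : 'D_v (fun q => c *: conn x q) y = c *: 'D_v (conn x) y.
  by apply: deriveZ; exact: smooth_derivable (smooth_conn x) Oy.
have E : 'D_v (conn (a *: u + b *: w)) y =
    a *: 'D_v (conn u) y + b *: 'D_v (conn w) y.
  rewrite -!dZ; apply: etrans _ (derive_addmx v (sZ a u) (sZ b w) Oy).
  by apply: (derive_eq_on openO v Oy) => q Oq; exact: conn_linear.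
rewrite E (conn_linear a b u w Oy); move: E => _.
move: ('D_u _ y) ('D_w _ y) ('D_v (conn u) y) ('D_v (conn w) y) => d1 d2 d3 d4.
move: (conn u y) (conn v y) (conn w y) => Nu Nv Nw.
rewrite !(mulmxDr, mulmxDl) -!(scalemxAl, scalemxAr).
by apply/matrixP => i j; rewrite !mxE; ring.
Qed.

Lemma ricci_identity m (X : vec -> 'M[R]_(m, n)) u v y : smooth_on O X -> O y ->
  cov u (cov v X) y - cov v (cov u X) y = X y *m riem u v y.
Proof.
move=> sX Oy.
have sXN w : smooth_on O (fun q => X q *m conn w q).
  by apply: smooth_mulmx => //; exact: smooth_conn.
have E a b : cov a (cov b X) y = 'D_a ('D_b X) y +
   ('D_a X y *m conn b y + X y *m 'D_a (conn b) y) +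
   ('D_b X y + X y *m conn b y) *m conn a y.
  rewrite {1}/cov; congr (_ + _).
  rewrite (derive_addmx a (smooth_derive b sX) (sXN b) Oy).
  by rewrite (derive_mulmx openO a sX (smooth_conn b) Oy).
rewrite (E u v) (E v u) (derive_mx_comm openO v u sX Oy).
rewrite /riem; move: ('D_u ('D_v X) y) ('D_u X y) ('D_v X y) => X2 Xu Xv.
move: ('D_u (conn v) y) ('D_v (conn u) y) => Nuv Nvu.
rewrite !(mulmxBr, mulmxDl, mulmxDr) !mulmxA.
move: (X y *m conn v y *m conn u y) (X y *m conn u y *m conn v y) => a b.
move: (X y *m Nuv) (X y *m Nvu) (Xu *m conn v y) (Xv *m conn u y) => c d e f.
by apply/matrixP => i j; rewrite !mxE; ring.
Qed.

Lemma riem_cst (w u v y : vec) : O y ->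
  cov u (fun q => w *m conn v q) y - cov v (fun q => w *m conn u q) y =
  w *m riem u v y.
Proof.
move=> Oy; rewrite -(ricci_identity u v (smooth_cst openO w) Oy).
by congr (_ - _); apply: cov_eq => // q Oq; rewrite cov_cst.
Qed.

(** Follows from the absence of torsion, as the covariant derivatives in constant
    directions commute up to curvature. *)
Lemma riem_bianchi (u v w y : vec) : O y ->
  w *m riem u v y + u *m riem v w y + v *m riem w u y = 0.
Proof.
move=> Oy; rewrite -!riem_cst //.
have E (a b c : vec) : cov a (fun q => b *m conn c q) y = cov a (fun q => c *m conn b q) y.
  by apply: cov_eq => // q Oq; exact: conn_sym.
rewrite (E u w v) (E v u w) (E w v u).
move: (cov u _ y) (cov v _ y) (cov w _ y) => a b c.
by apply/rowP => i; rewrite !mxE; ring.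
Qed.

(** The second derivatives of the function [ip (G q) w z] commute; expanding both
    by compatibility with the metric, the mixed terms cancel. *)
Lemma riem_skew (u v y w z : vec) : O y ->
  ip (G y) (w *m riem u v y) z = - ip (G y) w (z *m riem u v y).
Proof.
move=> Oy.
have sc (a : vec) : smooth_on O (fun _ : vec => a) := smooth_cst openO a.
have sN (a b : vec) : smooth_on O (fun q => a *m conn b q).
  by apply: smooth_mulmx => //; exact: smooth_conn.
have D1 a q : O q -> 'D_a (fun q => ip (G q) w z) q =
    ip (G q) (w *m conn a q) z + ip (G q) w (z *m conn a q).
  by move=> Oq; rewrite (derive_ip_cov a Oq (sc w) (sc z)) !cov_cst.
have D2 a b : 'D_b ('D_a (fun q => ip (G q) w z)) y =
    ip (G y) (cov b (fun q => w *m conn a q) y) z +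
    ip (G y) (w *m conn a y) (z *m conn b y) +
    (ip (G y) (w *m conn b y) (z *m conn a y) +
    ip (G y) w (cov b (fun q => z *m conn a q) y)).
  rewrite (derive_eq_on openO _ Oy (D1 a)).
  apply: etrans (deriveD _ _) _.
  - exact: smooth_derivable (smooth_ip openO smoothG (sN w a) (sc z)) Oy.
  - exact: smooth_derivable (smooth_ip openO smoothG (sc w) (sN z a)) Oy.
  rewrite (derive_ip_cov b Oy (sN w a) (sc z)).
  by rewrite (derive_ip_cov b Oy (sc w) (sN z a)) !cov_cst.
have C := derive_comm openO u v (smooth_ip openO smoothG (sc w) (sc z)) Oy.
have E := etrans (esym (D2 u v)) (etrans C (D2 v u)).
have P : ip (G y) (w *m riem u v y) z =
    ip (G y) (cov u (fun q => w *m conn v q) y) z -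
    ip (G y) (cov v (fun q => w *m conn u q) y) z.
  exact: etrans (congr1 (ip (G y) ^~ z) (esym (riem_cst w u v Oy))) (ipBl _ _ _ _).
have Q : ip (G y) w (z *m riem u v y) =
    ip (G y) w (cov u (fun q => z *m conn v q) y) -
    ip (G y) w (cov v (fun q => z *m conn u q) y).
  exact: etrans (congr1 (ip (G y) w) (esym (riem_cst z u v Oy))) (ipBr _ _ _ _).
exact: etrans P (etrans (cross_terms_cancel E) (esym (congr1 -%R Q))).
Qed.

(** A parallel endomorphism commutes with covariant derivatives, hence with their
    commutators. *)
Lemma riem_parallel (J : vec -> 'M[R]_n) : smooth_on O J ->
  (forall u q, O q -> cov_end u J q = 0) ->
  forall u v y, O y -> J y *m riem u v y = riem u v y *m J y.
Proof.
move=> sJ pJ u v y Oy.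
apply/row_matrixP => i; rewrite !rowE; set w := delta_mx 0 i; rewrite !mulmxA.
have sc : smooth_on O (fun _ : vec => w) := smooth_cst openO w.
have sm : smooth_on O (fun q => w *m J q) := smooth_mulmx openO sc sJ.
have sN b : smooth_on O (fun q => w *m conn b q).
  by apply: smooth_mulmx => //; exact: smooth_conn.
rewrite -(ricci_identity u v sm Oy) -riem_cst // mulmxBl.
have E a b : cov a (cov b (fun q => w *m J q)) y =
             cov a (fun q => w *m conn b q) y *m J y.
  have -> : cov a (cov b (fun q => w *m J q)) y =
            cov a (fun q => w *m conn b q *m J q) y.
    apply: cov_eq => // q Oq.
    by rewrite (cov_mulmx b Oq sc sJ) cov_cst pJ // mulmx0 addr0.
  by rewrite (cov_mulmx a Oy (sN b) sJ) pJ // mulmx0 addr0.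
by rewrite (E u v) (E v u).
Qed.

Lemma curvE (u v w z y : vec) : O y ->
  curv G y u v w z = ip (G y) (w *m riem u v y) z.
Proof.
move=> Oy; rewrite /curv; congr (ip _ _ _).
have N (a b q : vec) : O q -> nabla G (cst a) (cst b) q = b *m conn a q.
  by move=> Oq; rewrite /nabla derive_cst add0r christoffelE.
have NN a b : nabla G (cst a) (nabla G (cst b) (cst w)) y =
    cov a (fun q => w *m conn b q) y.
  have := N b w; move: (nabla G (cst b) (cst w)) => F NF.
  rewrite /nabla /= christoffelE // /cov (NF y Oy).
  by rewrite (derive_eq_on openO a Oy (fun q => NF q)).
rewrite /curv_op (NN u v) (NN v u) -riem_cst //.
rewrite /nabla /bracket !derive_cst subrr add0r christoffelE //.
by rewrite conn_sym // mul0mx subr0.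
Qed.

End LeviCivita.

(** * Consequences of the Calabi condition at a point *)

Section ComplexLine.
Context {R : realType} {n : nat}.
Local Notation vec := 'rV[R]_n.
Variables (G J : 'M[R]_n) (xi : vec).
Hypothesis symG : G^T = G.
Hypothesis posG : forall v, v != 0 -> 0 < ip G v v.
Hypothesis skJ : forall u v, ip G (u *m J) v = - ip G u (v *m J).
Hypothesis JJ : forall u : vec, u *m J *m J = - u.
Hypothesis xi0 : xi != 0.

Definition perp (z : vec) := ip G z xi = 0 /\ ip G z (xi *m J) = 0.

Let nn := ip G xi xi.

Let nn0 : nn != 0.
Proof. by rewrite gt_eqF // posG. Qed.

Lemma ip_J_self u : ip G u (u *m J) = 0.
Proof.
by have := skJ u u; rewrite [in LHS](ipC symG) => E; lra.
Qed.

Lemma ip_JJ u v : ip G (u *m J) (v *m J) = ip G u v.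
Proof. by rewrite skJ JJ ipNr opprK. Qed.

Lemma perpJ z : perp z -> perp (z *m J).
Proof. by move=> [z1 z2]; split; rewrite ?ip_JJ // skJ z2 oppr0. Qed.

Lemma perpD a b z w : perp z -> perp w -> perp (a *: z + b *: w).
Proof.
by move=> [z1 z2] [w1 w2]; split; rewrite ipDl !ipZl ?z1 ?z2 ?w1 ?w2 !mulr0 addr0.
Qed.

Lemma perp_decomp v : exists a b z, perp z /\ v = a *: xi + b *: (xi *m J) + z.
Proof.
set a := ip G v xi / nn; set b := ip G v (xi *m J) / nn.
exists a, b, (v - (a *: xi + b *: (xi *m J))); split; last by rewrite addrC subrK.
split; rewrite ipBl ipDl !ipZl ?ip_JJ ?ip_J_self ?skJ ?ip_J_self -/nn /a /b.
  by field.
by field.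
Qed.

End ComplexLine.

(** The data of the Calabi condition at one point.  [A] stands for the covariant
    derivative of [xi], skew for a Killing field and commuting with [J] for a
    Hamiltonian one, and [phi] for the differential of the logarithm of the
    conformal factor.  The last field is the derivative of [xi *m (J - I) = 0]
    combined with the formula for the derivative of [I] under conformal change. *)
Record calabi_point {R : realType} {n : nat} (G J I A : 'M[R]_n)
    (xi : 'rV[R]_n) (phi : 'rV[R]_n -> R) : Prop := CalabiPoint {
  cp_sym : G^T = G;
  cp_pos : forall v, v != 0 -> 0 < ip G v v;
  cp_skewJ : forall u v, ip G (u *m J) v = - ip G u (v *m J);
  cp_sqrJ : forall u : 'rV[R]_n, u *m J *m J = - u;
  cp_xi_neq0 : xi != 0;
  cp_xiI : xi *m I = xi *m J;
  cp_xiJI : xi *m J *m I = - xi;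
  cp_perpI : forall z, perp G J xi z -> z *m I = - (z *m J);
  cp_skewA : forall u v, ip G (u *m A) v = - ip G u (v *m A);
  cp_comm : forall u : 'rV[R]_n, u *m A *m J = u *m J *m A;
  cp_phi_linear : forall a b u v,
    phi (a *: u + b *: v) = a * phi u + b * phi v;
  cp_perp_neq0 : exists2 z, z != 0 & perp G J xi z;
  cp_lie : forall u z,
    ip G (u *m A *m (J - I)) z =
    - phi (xi *m I) * ip G u z + phi z * ip G u (xi *m I)
    + phi xi * ip G (u *m I) z + phi (z *m I) * ip G u xi }.

Section Opposite.
Context {R : realType} {n : nat}.
Local Notation vec := 'rV[R]_n.
Variables (G J I A : 'M[R]_n) (xi : vec) (phi : vec -> R).
Hypothesis CP : calabi_point G J I A xi phi.
Let symG := cp_sym CP.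
Let posG := cp_pos CP.
Let skJ := cp_skewJ CP.
Let JJ := cp_sqrJ CP.
Let xi0 := cp_xi_neq0 CP.
Let xiI := cp_xiI CP.
Let xiJI := cp_xiJI CP.
Let perpI := cp_perpI CP.
Let skA := cp_skewA CP.
Let AJ := cp_comm CP.
Let phi_lin := cp_phi_linear CP.
Let nabla_diff := cp_lie CP.
Local Notation perp := (perp G J xi).
Local Notation ipJ0 := (ip_J_self symG skJ).
Local Notation ipJJ := (ip_JJ skJ JJ).
Local Notation perp_J := (perpJ skJ JJ).
Local Notation decomp := (perp_decomp symG posG skJ JJ xi0).

Let nn := ip G xi xi.

Let nn0 : nn != 0.
Proof. by rewrite gt_eqF // posG. Qed.

Let phiN u : phi (- u) = - phi u.
Proof.
have := phi_lin (-1) 0 u 0.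
by rewrite scaleN1r scale0r addr0 mul0r addr0 mulN1r.
Qed.

Let phiD u v : phi (u + v) = phi u + phi v.
Proof. by have := phi_lin 1 1 u v; rewrite !scale1r !mul1r. Qed.

(** On the complex line of [xi] and on its complement, [I] is [J] up to sign. *)
Lemma opposite_skew u v : ip G (u *m I) v = - ip G u (v *m I).
Proof.
have [a [b [z [pz ->]]]] := decomp u.
have [c [d [w [pw ->]]]] := decomp v.
have pzJ := perp_J pz; have pwJ := perp_J pw.
rewrite !mulmxDl -!scalemxAl xiI xiJI !perpI //.
rewrite !(ipDl, ipDr, ipZl, ipZr, ipNl, ipNr).
case: pz pw pzJ pwJ => [z1 z2] [w1 w2] [z3 z4] [w3 w4].
rewrite (ipC symG (xi *m J) (w *m J)) (ipC symG xi (w *m J)).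
rewrite (ipC symG (xi *m J) w) (ipC symG xi w).
by rewrite ?z1 ?z2 ?z3 ?z4 ?w1 ?w2 ?w3 ?w4 skJ ipJ0 ipJJ (skJ z w); ring.
Qed.

Lemma opposite_diff_perp z : perp z -> z *m (J - I) = 2 *: (z *m J).
Proof. by move=> pz; rewrite mulmxBr perpI // opprK scaler_nat mulr2n. Qed.

Lemma opposite_diff_xi : xi *m (J - I) = 0.
Proof. by rewrite mulmxBr xiI subrr. Qed.

Lemma opposite_diff_xiJ : xi *m J *m (J - I) = 0.
Proof. by rewrite mulmxBr xiJI JJ subrr. Qed.

Lemma opposite_diff_skew u v : ip G (u *m (J - I)) v = - ip G u (v *m (J - I)).
Proof. by rewrite !mulmxBr ipBl ipBr skJ opposite_skew opprD. Qed.

Lemma ip_opposite_diff u z : perp z -> ip G (u *m (J - I)) z = - 2 * ip G u (z *m J).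
Proof. by move=> pz; rewrite opposite_diff_skew opposite_diff_perp // ipZr mulNr. Qed.

(** Pairing [cp_lie] at a vector [z] orthogonal to the complex line with [z *m J]
    isolates [phi xi] against a diagonal entry of the skew endomorphism [A]. *)
Lemma phi_xi0 : phi xi = 0.
Proof.
have [q q0 perpq] := cp_perp_neq0 CP.
have E := nabla_diff q (q *m J).
have pqJ := perp_J perpq.
rewrite ip_opposite_diff // JJ ipNr in E.
rewrite (perpI perpq) xiI (perpI pqJ) ipNl ipJ0 ipJJ in E.
case: (perpq) => e1 e2; rewrite e1 e2 !mulr0 in E.
have e3 : ip G (q *m A) q = 0.
  by have := skA q q; rewrite [in RHS](ipC symG) => e; lra.
rewrite e3 in E.
have : phi xi * ip G q q = 0 by lra.
by move/eqP; rewrite mulf_eq0 [ip G q q == 0]gt_eqF ?orbF ?posG // => /eqP.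
Qed.

(** [cp_lie] at [xi] and at [xi *m J] gives two values, of opposite signs, for the
    component of [xi *m A] along [z], because [A] commutes with [J]. *)
Lemma phi_perp z : perp z -> phi z = 0.
Proof.
move=> pz; have pzJ := perp_J pz.
have E1 := nabla_diff xi (z *m J); have E2 := nabla_diff (xi *m J) z.
rewrite phi_xi0 (ip_opposite_diff _ pzJ) JJ (perpI pzJ) JJ opprK xiI in E1.
rewrite phi_xi0 (ip_opposite_diff _ pz) (perpI pz) -AJ ipJJ phiN xiI in E2.
have [z1 z2] := pz; have [z3 z4] := pzJ.
rewrite ipJ0 (ipC symG xi (z *m J)) z3 in E1.
rewrite (ipC symG (xi *m J) z) z2 (ipJJ xi xi) (skJ xi xi) ipJ0 in E2.
rewrite -/nn ipNr in E1; rewrite -/nn in E2.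
have : phi z * nn = 0 by lra.
by move/eqP; rewrite mulf_eq0 (negbTE nn0) orbF => /eqP.
Qed.

(** With [phi_perp], [cp_lie] at [xi] has no term left. *)
Lemma ip_xiA_perp z : perp z -> ip G (xi *m A) z = 0.
Proof.
move=> pz; have pzJ := perp_J pz.
have E1 := nabla_diff xi (z *m J).
rewrite phi_xi0 (ip_opposite_diff _ pzJ) JJ (perpI pzJ) JJ opprK xiI in E1.
have [z1 z2] := pz; have [z3 z4] := pzJ.
rewrite ipJ0 (ipC symG xi (z *m J)) z3 ipNr (phi_perp pz) in E1.
by lra.
Qed.

Lemma nabla_perp z : perp z -> z *m A = (phi (xi *m J) / 2) *: (z *m J).
Proof.
move=> pz; apply: (ip_extl posG) => v.
have [a [b [w [pw ->]]]] := decomp v.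
have pzJ := perp_J pz; have pwJ := perp_J pw.
rewrite !(ipDr, ipZr, ipZl).
have -> : ip G (z *m A) xi = 0.
  by rewrite skA (ipC symG) ip_xiA_perp // oppr0.
have -> : ip G (z *m A) (xi *m J) = 0.
  by rewrite -[LHS]opprK -skJ AJ skA (ipC symG) ip_xiA_perp // !oppr0.
have [z3 z4] := pzJ; rewrite z3 z4.
have E := nabla_diff z (w *m J).
have [z1 z2] := pz.
rewrite phi_xi0 (ip_opposite_diff _ pwJ) JJ ipNr xiI z1 z2 in E.
by rewrite (skJ z w); lra.
Qed.

(** [xi *m A] has no component orthogonal to the complex line by [ip_xiA_perp], and
    none along [xi] because [A] is skew. *)
Lemma nabla_xi : exists a, xi *m A = a *: (xi *m J).
Proof.
have [a [b [z [pz E]]]] := decomp (xi *m A).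
exists b.
have z0 : z = 0.
  apply: (ip_eq0 posG); have := ip_xiA_perp pz.
  have [z1 z2] := pz.
  by rewrite E !ipDl !ipZl (ipC symG xi) z1 (ipC symG _ z) z2 !mulr0 !add0r.
have a0 : a = 0.
  have : ip G (xi *m A) xi = 0.
    by have := skA xi xi; rewrite [in RHS](ipC symG) => e; lra.
  rewrite E z0 addr0 ipDl !ipZl skJ ipJ0 -/nn oppr0 mulr0 addr0 => /eqP.
  by rewrite mulf_eq0 (negbTE nn0) orbF => /eqP.
by rewrite E z0 a0 scale0r add0r addr0.
Qed.

Lemma nabla_xi_diff : xi *m A *m (J - I) = 0.
Proof. by have [a ->] := nabla_xi; rewrite -scalemxAl opposite_diff_xiJ scaler0. Qed.

(** A form of [nabla_perp] without quantification over orthogonal vectors: both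
    sides vanish on the complex line, and [J - I] has its complement as image.
    As an equality of endomorphisms it can be differentiated. *)
Lemma diff_nabla : (J - I) *m A = (phi (xi *m J) / 2) *: ((J - I) *m J).
Proof.
apply/row_matrixP => i; rewrite !rowE -scalemxAr !mulmxA.
have [a [b [z [pz ->]]]] := decomp (delta_mx 0 i).
rewrite !mulmxDl -!scalemxAl opposite_diff_xi opposite_diff_xiJ !mul0mx !scaler0 !add0r.
rewrite opposite_diff_perp // -!scalemxAl (nabla_perp (perp_J pz)).
by rewrite !scalerA mulrC.
Qed.

(** Both sides vanish on [xi] and on the complement of the complex line. *)
Lemma phi_proportional v : nn * phi v = phi (xi *m J) * ip G (xi *m J) v.
Proof.
have [a [b [z [pz ->]]]] := decomp v.
rewrite phiD phi_lin phi_xi0 (phi_perp pz).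
have [z1 z2] := pz.
rewrite !(ipDr, ipZr) skJ ipJ0 ipJJ (ipC symG (xi *m J)) z2 -/nn; ring.
Qed.

Section SecondOrder.
Variables (dA dI : vec -> 'M[R]_n).
Let b := phi (xi *m J) / 2.
Hypothesis dI_xiJ : forall u, u *m A *m J *m (J - I) = xi *m J *m dI u.
Hypothesis dI_xiA : forall u,
  (u *m A *m A + xi *m dA u) *m (J - I) = xi *m A *m dI u.
Hypothesis dA_comm : forall u, dA u *m J = J *m dA u.
Hypothesis dA_skew : forall u v w, ip G (v *m dA u) w = - ip G v (w *m dA u).
Hypothesis dA_diff : forall u, perp u ->
  (J - I) *m dA u = dI u *m (A - b *: J).

(** The curvature [R(u, w, xi, z)], by [riem_form_xi]. *)
Definition xi_curv (u w z : vec) := ip G (w *m dA u) z - ip G (u *m dA w) z.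

(** In [dI_xiA] every term other than [xi *m dA u] lies in the image of the complex
    line under [J - I], which is zero. *)
Lemma xi_dA_line u z : u = xi \/ u = xi *m J -> perp z -> ip G (xi *m dA u) z = 0.
Proof.
move=> Hu pz; have [a Ea] := nabla_xi.
have [c Ec] : exists c d, u *m A = c *: xi + d *: (xi *m J).
  case: Hu => ->; first by exists 0, a; rewrite scale0r add0r.
  by exists (- a), 0; rewrite -AJ Ea -scalemxAl JJ scalerN scaleNr scale0r addr0.
move: Ec => [d Ec].
have E := dI_xiA u.
have e1 : u *m A *m J *m (J - I) = 0.
  rewrite Ec !mulmxDl -!scalemxAl JJ mulNmx opposite_diff_xi opposite_diff_xiJ oppr0.
  by rewrite !scaler0 addr0.
have e2 : u *m A *m A *m (J - I) = 0.
  rewrite Ec !mulmxDl -!scalemxAl nabla_xi_diff -AJ Ea -!scalemxAl JJ mulNmx.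
  by rewrite opposite_diff_xi oppr0 !scaler0 addr0.
rewrite Ea -scalemxAl -dI_xiJ e1 scaler0 mulmxDl e2 add0r in E.
have := ip_opposite_diff (xi *m dA u) (perp_J pz).
by rewrite E ip0l JJ ipNr => e; lra.
Qed.

Lemma xi_curv_line z : perp z -> xi_curv xi (xi *m J) z = 0.
Proof.
move=> pz; rewrite /xi_curv -mulmxA -dA_comm mulmxA skJ.
rewrite (xi_dA_line (or_introl erefl) (perp_J pz)).
by rewrite (xi_dA_line (or_intror erefl) pz) !oppr0 addr0.
Qed.

(** In [dA_diff], paired with [z], the right-hand side vanishes since [A - b *: J]
    is skew and kills [z] by [nabla_perp]. *)
Lemma cov_nabla_perp3 u v z : perp u -> perp v -> perp z -> ip G (v *m dA u) z = 0.
Proof.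
move=> pu pv pz.
have pvJ := perp_J pv.
have := congr1 (fun M : 'M[R]_n => ip G (v *m J *m M) z) (dA_diff pu).
rewrite !mulmxA opposite_diff_perp // JJ -scalemxAl mulNmx ipZl ipNl.
rewrite mulmxBr ipBl skA -scalemxAr ipZl skJ (nabla_perp pz) -/b ipZr => e.
lra.
Qed.

Lemma xi_curv_perp u w z : perp u -> perp w -> perp z -> xi_curv u w z = 0.
Proof. by move=> *; rewrite /xi_curv !cov_nabla_perp3 // subrr. Qed.

(** The term [dA xi] drops out since it is skew, and [dI_xiA] evaluates the other one. *)
Lemma xi_curv_mixed : exists C, forall w, perp w -> xi_curv xi w w = C * ip G w w.
Proof.
have [a Ea] := nabla_xi; exists (a * b - b ^+ 2) => w pw.
have pwJ := perp_J pw; rewrite /xi_curv.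
have -> : ip G (w *m dA xi) w = 0.
  by have := dA_skew xi w w; rewrite [in RHS](ipC symG) => e; lra.
have E := dI_xiA w.
rewrite Ea -scalemxAl -dI_xiJ (nabla_perp pw) -/b -!scalemxAl (nabla_perp pwJ) -/b in E.
rewrite !JJ !scalerA !scalerN mulmxDl !mulNmx -scalemxAl scalerN in E.
have := ip_opposite_diff (xi *m dA w) pwJ.
have -> : xi *m dA w *m (J - I) = (b * b - a * b) *: (w *m (J - I)).
  by move/eqP: E; rewrite addrC subr_eq => /eqP ->; rewrite scalerBl addrC.
rewrite ipZl ip_opposite_diff // JJ !ipNr => e.
by rewrite expr2; lra.
Qed.

End SecondOrder.
End Opposite.

(** * Algebraic curvature tensors of Kähler type *)

(** The classical octahedron argument: the four cyclic identities on the faces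
    combine, through the antisymmetries, into the symmetry under exchange of pairs. *)
Lemma curvature_pair_sym {R : realFieldType} (T : Type) (q : T -> T -> T -> T -> R) :
  (forall u v w z, q u v w z = - q v u w z) ->
  (forall u v w z, q u v w z = - q u v z w) ->
  (forall u v w z, q u v w z + q v w u z + q w u v z = 0) ->
  forall u v w z, q u v w z = q w z u v.
Proof.
move=> s12 s34 b u v w z.
have b1 := b u v w z; have b2 := b v w z u; have b3 := b w z u v.
have b4 := b z u v w.
have e1 := s34 v w z u; have e2 := s34 w z v u; have e3 := s34 z v w u.
have e4 := s12 w z u v; have e5 := s12 w u v z; have e6 := s34 u w v z.
have e7 := s34 z u w v; have e8 := s12 z u v w; have e9 := s34 u v w z.
have e10 := s12 z v w u; have e11 := s12 v z w u; have e12 := s34 v z w u.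
have e13 := s34 u z v w; have e14 := s12 u z w v; have e15 := s12 u w z v.
have e16 := s12 u v z w; have e17 := s34 w z u v; have e18 := s34 v z u w.
have e19 := s34 u w z v; have e20 := s34 w u v z; have e21 := s34 w u z v.
have e22 := s34 z u v w; have e23 := s12 u v w z; have e24 := s12 z v u w.
lra.
Qed.

Record kahler_tensor {R : realType} {n : nat} (J : 'M[R]_n)
    (q : 'rV[R]_n -> 'rV[R]_n -> 'rV[R]_n -> 'rV[R]_n -> R) : Prop := KahlerTensor {
  kt_sqrJ : forall u : 'rV[R]_n, u *m J *m J = - u;
  kt_linear1 : forall a b u v x y z,
    q (a *: u + b *: v) x y z = a * q u x y z + b * q v x y z;
  kt_linear3 : forall a b u v x y z,
    q x y (a *: u + b *: v) z = a * q x y u z + b * q x y v z;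
  kt_antisym12 : forall u v w z, q u v w z = - q v u w z;
  kt_antisym34 : forall u v w z, q u v w z = - q u v z w;
  kt_bianchi : forall u v w z, q u v w z + q v w u z + q w u v z = 0;
  kt_J34 : forall u v w z, q u v (w *m J) (z *m J) = q u v w z }.

Section KahlerCurvature.
Context {R : realType} {n : nat}.
Local Notation vec := 'rV[R]_n.
Variables (J : 'M[R]_n) (q : vec -> vec -> vec -> vec -> R).
Hypothesis KT : kahler_tensor J q.
Let JJ := kt_sqrJ KT.
Let q_lin1 := kt_linear1 KT.
Let q_lin3 := kt_linear3 KT.
Let s12 := kt_antisym12 KT.
Let s34 := kt_antisym34 KT.
Let bianchi := kt_bianchi KT.
Let pair := curvature_pair_sym s12 s34 bianchi.
Let qJ34 := kt_J34 KT.

Lemma q_lin2 a b u v x y z :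
  q x (a *: u + b *: v) y z = a * q x u y z + b * q x v y z.
Proof. by rewrite s12 q_lin1 (s12 x u) (s12 x v); ring. Qed.

Lemma q_lin4 a b u v x y z :
  q x y z (a *: u + b *: v) = a * q x y z u + b * q x y z v.
Proof. by rewrite s34 q_lin3 (s34 x y z u) (s34 x y z v); ring. Qed.

Lemma qJ12 u v w z : q (u *m J) (v *m J) w z = q u v w z.
Proof. by rewrite pair qJ34 pair. Qed.

Lemma qN3 u v w z : q u v (- w) z = - q u v w z.
Proof.
have := q_lin3 (-1) 0 w w u v z.
by rewrite scaleN1r scale0r addr0 mul0r addr0 mulN1r.
Qed.

Lemma qN4 u v w z : q u v w (- z) = - q u v w z.
Proof. by rewrite s34 qN3 -s34. Qed.

Lemma q_diag12 u w z : q u u w z = 0.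
Proof. by have := s12 u u w z => e; lra. Qed.

Lemma q_diag34 u v w : q u v w w = 0.
Proof. by rewrite pair q_diag12. Qed.

Lemma qJ3 u v w z : q u v (w *m J) z = - q u v w (z *m J).
Proof. by rewrite -(qJ34 u v w) JJ qN4 opprK. Qed.

Lemma qJ1 u v w z : q (u *m J) v w z = - q u (v *m J) w z.
Proof. by rewrite pair qJ3 -pair. Qed.

(** The numerator of the holomorphic sectional curvature. *)
Definition hol_form (u : vec) := q u (u *m J) (u *m J) u.

(** A vector and its multiple by a complex number span the same real plane, so only
    the area form of the plane is rescaled. *)
Lemma hol_form_rotate a b u :
  hol_form (a *: u + b *: (u *m J)) = (a ^+ 2 + b ^+ 2) ^+ 2 * hol_form u.
Proof.
have -> : hol_form (a *: u + b *: (u *m J)) =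
    q (a *: u + b *: (u *m J)) (a *: (u *m J) + (- b) *: u)
      (a *: (u *m J) + (- b) *: u) (a *: u + b *: (u *m J)).
  by rewrite /hol_form mulmxDl -!scalemxAl JJ scalerN scaleNr.
rewrite q_lin1 !q_lin2 !q_lin3 !q_lin4 !q_diag12 !q_diag34.
rewrite /hol_form !(s12 (u *m J) u) !(s34 _ _ u (u *m J)); ring.
Qed.

Section Split.
Variables (xi : vec) (P : vec -> Prop) (N : vec -> R) (C : R).
Hypothesis PJ : forall z, P z -> P (z *m J).
Hypothesis NJ : forall z, N (z *m J) = N z.
Hypothesis q_line : forall z, P z -> q xi (xi *m J) xi z = 0.
Hypothesis q_perp : forall x y z, P x -> P y -> P z -> q x y xi z = 0.
Hypothesis q_mixed : forall w, P w -> q xi w xi w = C * N w.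

(** Expanding into sixteen components, those with an odd number of entries [z]
    reduce to [q_line] and [q_perp], and the six with two entries [z] all reduce
    to [q_mixed], the two of type [q xi (xi *m J) (z *m J) z] by means of the
    Bianchi identity. *)
Lemma hol_form_split t z : P z ->
  hol_form (t *: xi + z) = t ^+ 4 * hol_form xi - 8 * C * t ^+ 2 * N z + hol_form z.
Proof.
move=> Pz; have PzJ := PJ Pz.
have -> : hol_form (t *: xi + z) =
    q (t *: xi + 1 *: z) (t *: (xi *m J) + 1 *: (z *m J))
      (t *: (xi *m J) + 1 *: (z *m J)) (t *: xi + 1 *: z).
  by rewrite /hol_form mulmxDl -!scalemxAl !scale1r.
rewrite q_lin1 !q_lin2 !q_lin3 !q_lin4 -/(hol_form xi) -/(hol_form z).
have a1 : q xi (xi *m J) (xi *m J) z = 0 by rewrite qJ3 q_line // oppr0.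
have a2 : q xi (xi *m J) (z *m J) xi = 0 by rewrite s34 q_line // oppr0.
have a3 : q xi (z *m J) (xi *m J) xi = 0 by rewrite pair s12 q_line ?oppr0 //; exact: PJ.
have a4 : q z (xi *m J) (xi *m J) xi = 0 by rewrite pair s12 s34 a1 !oppr0.
have b1 : q z (z *m J) (z *m J) xi = 0 by rewrite s34 q_perp // oppr0.
have b2 : q z (z *m J) (xi *m J) z = 0 by rewrite qJ3 q_perp // oppr0.
have b3 : q z (xi *m J) (z *m J) z = 0.
  by rewrite pair s34 qJ3 q_perp // !oppr0.
have b4 : q xi (z *m J) (z *m J) z = 0.
  by rewrite pair q_perp.
have m0 := q_mixed PzJ; have m1 := q_mixed Pz; rewrite NJ in m0.
have c1 : q xi (z *m J) (z *m J) xi = - (C * N z) by rewrite s34 m0.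
have c2 : q z (xi *m J) (xi *m J) z = - (C * N z).
  by rewrite qJ3 -qJ1 s12 m0.
have c3 : q xi (z *m J) (xi *m J) z = - (C * N z) by rewrite qJ3 m0.
have c4 : q z (xi *m J) (z *m J) xi = - (C * N z) by rewrite pair s34 s12 c3 opprK.
have c5 : q xi (xi *m J) (z *m J) z = - 2 * (C * N z).
  have := bianchi xi (xi *m J) (z *m J) z.
  rewrite qJ12 m1 (s12 (z *m J)) c3 => e; lra.
have c6 : q z (z *m J) (xi *m J) xi = - 2 * (C * N z).
  by rewrite pair s12 s34 c5 opprK.
rewrite a1 a2 a3 a4 b1 b2 b3 b4 c1 c2 c3 c4 c5 c6; ring.
Qed.

End Split.
End KahlerCurvature.

Section Plane.
Context {R : realType} {n : nat}.
Local Notation vec := 'rV[R]_n.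
Variables (G J : 'M[R]_n) (q : vec -> vec -> vec -> vec -> R) (xi q0 : vec).
Hypothesis symG : G^T = G.
Hypothesis posG : forall v, v != 0 -> 0 < ip G v v.
Hypothesis skJ : forall u v, ip G (u *m J) v = - ip G u (v *m J).
Hypothesis KT : kahler_tensor J q.
Hypothesis q00 : q0 != 0.
Hypothesis plane : forall z, perp G J xi z -> exists a b, z = a *: q0 + b *: (q0 *m J).
Variable C : R.
Hypothesis split : forall t z, perp G J xi z ->
  hol_form J q (t *: xi + z) =
  t ^+ 4 * hol_form J q xi - 8 * C * t ^+ 2 * ip G z z + hol_form J q z.

Let JJ := kt_sqrJ KT.

Let kappa := hol_form J q q0 / ip G q0 q0 ^+ 2.

(** The orthogonal complement is a single complex line, so every vector in it is a
    complex multiple of [q0]. *)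
Lemma hol_form_perp z : perp G J xi z -> hol_form J q z = kappa * ip G z z ^+ 2.
Proof.
move=> /plane[a [b ->]].
have n0 : ip G q0 q0 != 0 by rewrite gt_eqF // posG.
have -> : ip G (a *: q0 + b *: (q0 *m J)) (a *: q0 + b *: (q0 *m J)) =
    (a ^+ 2 + b ^+ 2) * ip G q0 q0.
  rewrite !(ipDl, ipDr, ipZl, ipZr) (ip_JJ skJ JJ) skJ (ip_J_self symG skJ).
  ring.
by rewrite (hol_form_rotate KT) /kappa; field.
Qed.

(** Multiplying the vector by the complex number [a - i b] turns its component along
    the complex line into a real multiple of [xi], to which [split] applies;
    dividing by the power of the modulus avoids square roots. *)
Lemma hol_form_formula a b z : perp G J xi z -> let r := a ^+ 2 + b ^+ 2 in
  hol_form J q (a *: xi + b *: (xi *m J) + z) =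
  r ^+ 2 * hol_form J q xi - 8 * C * r * ip G z z + kappa * ip G z z ^+ 2.
Proof.
move=> pz r.
have [r0|r0] := eqVneq r 0.
  have a0 : a = 0.
    apply/eqP; rewrite -[a == 0](expf_eq0 _ 2); apply/eqP; rewrite /r in r0.
    by have := sqr_ge0 a; have := sqr_ge0 b; lra.
  have b0 : b = 0.
    apply/eqP; rewrite -[b == 0](expf_eq0 _ 2); apply/eqP; rewrite /r in r0.
    by have := sqr_ge0 a; have := sqr_ge0 b; lra.
  by rewrite a0 b0 !scale0r !add0r r0 hol_form_perp //; ring.
set u := _ + z.
(* Multiplication by [a - i b] sends [a *: xi + b *: (xi *m J)] to [r *: xi]. *)
have E : a *: u + (- b) *: (u *m J) =
    r *: xi + (a *: z + (- b) *: (z *m J)).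
  rewrite /u /r !mulmxDl -!scalemxAl JJ.
  by apply/rowP => c; rewrite !mxE; ring.
have pz' : perp G J xi (a *: z + (- b) *: (z *m J)).
  by apply: perpD => //; exact: perpJ.
have Nz : ip G (a *: z + (- b) *: (z *m J)) (a *: z + (- b) *: (z *m J)) =
    r * ip G z z.
  rewrite !(ipDl, ipDr, ipZl, ipZr) (ip_JJ skJ JJ) skJ (ip_J_self symG skJ) /r.
  ring.
have := hol_form_rotate KT a (- b) u.
rewrite E (split r pz') (hol_form_perp pz') Nz sqrrN -/r => H.
apply: (mulfI (expf_neq0 2 r0)); rewrite -H; ring.
Qed.

End Plane.

(** * Kähler structures in a chart *)

(** With [t] the covariant derivative of [J], this is how the two Kähler conditions
    force it to vanish.  The expression
    [s u v w = t (j u) v w + t u v (j w)] is symmetric in its first two arguments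
    by the last hypothesis and skew in its last two, hence zero; comparing the
    cyclic identity with its image under [j] then isolates a single term. *)
Lemma hermitian_defect_eq0 {R : realType} (T : Type) (j : T -> T)
    (t : T -> T -> T -> R) :
  (forall u v w, t u v (j (j w)) = - t u v w) ->
  (forall u v w, t u v w = - t u w v) ->
  (forall u v w, t u (j v) w = t u v (j w)) ->
  (forall u v w, t u v w + t v w u + t w u v = 0) ->
  (forall u v w, t (j u) v w + t u v (j w) = t (j v) u w + t v u (j w)) ->
  forall u v w, t u v w = 0.
Proof.
move=> jj skew anti cyc nij.
pose s u v w := t (j u) v w + t u v (j w).
have s_sym u v w : s u v w = s v u w by exact: nij.
have s_skew u v w : s u v w = - s u w v.
  have e1 := skew (j u) v w; have e2 := anti u v w; have e3 := skew u (j v) w.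
  by rewrite /s -e2 e3 e1; ring.
have s0 u v w : s u v w = 0.
  have e1 := s_skew u v w; have e2 := s_sym u w v; have e3 := s_skew w u v.
  have e4 := s_sym w v u; have e5 := s_skew v w u; have e6 := s_sym v u w.
  lra.
have tj u v w : t (j u) v w = - t u v (j w).
  by apply/eqP; rewrite -addr_eq0; apply/eqP; exact: s0.
move=> v w u.
have e0 := cyc (j u) v (j w); have e1 := cyc u v w.
have e2 : t (j u) v (j w) = t u v w by rewrite tj jj opprK.
have e3 : t v (j w) (j u) = - t v w u by rewrite anti jj.
have e4 : t (j w) (j u) v = t w u v by rewrite tj anti jj opprK.
rewrite e2 e3 e4 in e0.
lra.
Qed.

(** The conditions of a Kähler surface in one chart, in any dimension. *)
Record kahler_on {R : realType} {n : nat} (O : set 'rV[R]_n)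
    (G J : 'rV[R]_n -> 'M[R]_n) : Prop := KahlerOn {
  kahler_smoothG : smooth_on O G;
  kahler_symG : forall y, O y -> (G y)^T = G y;
  kahler_posG : forall y v, O y -> v != 0 -> 0 < ip (G y) v v;
  kahler_smoothJ : smooth_on O J;
  kahler_sqrJ : forall y, O y -> J y *m J y = - 1%:M;
  kahler_isom : forall y u v, O y ->
    ip (G y) (u *m J y) (v *m J y) = ip (G y) u v;
  kahler_nij : forall X Y, smooth_on O X -> smooth_on O Y ->
    forall y, O y -> nijenhuis J X Y y = 0;
  kahler_closed : forall X Y Z, smooth_on O X -> smooth_on O Y ->
    smooth_on O Z -> forall y, O y ->
    ext_deriv2 (kahler_form G J) X Y Z y = 0 }.

Section KahlerParallel.
Context {R : realType} {n : nat} (O : set 'rV[R]_n).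
Hypothesis openO : open O.
Local Notation vec := 'rV[R]_n.
Variables (G J : vec -> 'M[R]_n).
Hypothesis K : kahler_on O G J.
Let sG := kahler_smoothG K.
Let symG := kahler_symG K.
Let posG := kahler_posG K.
Let sJ := kahler_smoothJ K.

Lemma kahler_skew y (u v : vec) : O y ->
  ip (G y) (u *m J y) v = - ip (G y) u (v *m J y).
Proof.
move=> Oy; rewrite -[in RHS](kahler_isom K u _ Oy) -mulmxA (kahler_sqrJ K Oy).
by rewrite mulmxN mulmx1 ipNr opprK.
Qed.

Lemma kahler_JJ y m (u : 'M[R]_(m, n)) : O y -> u *m J y *m J y = - u.
Proof. by move=> Oy; rewrite -mulmxA (kahler_sqrJ K Oy) mulmxN mulmx1. Qed.

Let sc (a : vec) : smooth_on O (fun _ : vec => a) := smooth_cst openO a.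
Let sa (a : vec) : smooth_on O (fun q => a *m J q) := smooth_mulmx openO (sc a) sJ.

Lemma cov_end_sqr_anti u y : O y ->
  cov_end G u J y *m J y + J y *m cov_end G u J y = 0.
Proof.
move=> Oy; rewrite -(cov_end_mulmx openO G u Oy sJ sJ).
rewrite (cov_end_eq openO G u Oy (fun q => kahler_sqrJ K (y:=q))).
by rewrite /cov_end derive_cstmx add0r mulmxN mulNmx mulmx1 mul1mx subrr.
Qed.

(** Since the metric is parallel, the exterior derivative of the Kähler form is the
    cyclic sum of its covariant derivatives; torsion would give the other terms. *)
Lemma kahler_form_cyclic u v w y : O y ->
  ip (G y) (v *m cov_end G u J y) w + ip (G y) (w *m cov_end G v J y) u +
  ip (G y) (u *m cov_end G w J y) v = 0.
Proof.
move=> Oy.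
have D a b c : 'D_a (fun q => kahler_form G J q b c) y =
    ip (G y) (b *m cov_end G a J y) c - ip (G y) (b *m conn G a y) (c *m J y)
    + ip (G y) (b *m J y) (c *m conn G a y).
  rewrite /kahler_form (derive_ip_cov openO sG symG posG a Oy (sa b) (sc c)).
  rewrite (cov_mulmx openO G a Oy (sc b) sJ) !cov_cst ipDl.
  by rewrite (kahler_skew _ _ Oy); congr (_ + _); rewrite addrC.
have := kahler_closed K (sc u) (sc v) (sc w) Oy.
rewrite /ext_deriv2 /bracket !derive_cst !subrr.
rewrite [kahler_form G J y 0 w]/kahler_form [kahler_form G J y 0 u]/kahler_form.
rewrite [kahler_form G J y 0 v]/kahler_form !mul0mx !ip0l !subr0.
rewrite (D u v w) (D v w u) (D w u v).
have S a b c : ip (G y) (a *m conn G b y) (c *m J y) =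
               ip (G y) (c *m J y) (b *m conn G a y).
  by rewrite (ipC (symG Oy)) (conn_sym openO sG symG posG a b Oy).
rewrite (S v u w) (S w v u) (S u w v).
move: (ip _ _ (u *m conn G v y)) => a.
move: (ip _ _ (v *m conn G w y)) => b.
move: (ip _ _ (w *m conn G u y)) => c.
move: (cov_end G u J y) (cov_end G v J y) (cov_end G w J y) => T1 T2 T3.
by move: (ip _ _ _) (ip _ _ _) (ip _ _ _) => p q r; lra.
Qed.

(** In the Nijenhuis tensor all connection terms cancel by absence of torsion. *)
Lemma nijenhuis_cov_end u v y : O y ->
  v *m cov_end G (u *m J y) J y - u *m cov_end G (v *m J y) J y
  + u *m cov_end G v J y *m J y - v *m cov_end G u J y *m J y = 0.
Proof.
move=> Oy.
have D (a b : vec) : 'D_a (fun q => b *m J q) y =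
    b *m conn G a y *m J y + b *m cov_end G a J y - b *m J y *m conn G a y.
  have E := cov_mulmx openO G a Oy (sc b) sJ.
  by rewrite cov_cst in E; rewrite -E /cov addrK.
rewrite -(kahler_nij K (sc u) (sc v) Oy).
rewrite /nijenhuis /bracket !derive_cst !subr0 !sub0r.
rewrite (D (u *m J y) v) (D (v *m J y) u) (D u v) (D v u).
have e1 := conn_sym openO sG symG posG v (u *m J y) Oy.
have e2 := conn_sym openO sG symG posG u (v *m J y) Oy.
have e3 := conn_sym openO sG symG posG (v *m J y) (u *m J y) Oy.
have e4 := conn_sym openO sG symG posG u v Oy.
rewrite e1 e2 e3 e4 !(mulNmx, mulmxBl, mulmxDl).
move: (cov_end G _ J y) (cov_end G _ J y) (cov_end G u J y) (cov_end G v J y) => T1 T2 T3 T4.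
move: (conn G u y) (conn G v y) (conn G _ y) => N1 N2 N3.
by apply/rowP => c; rewrite !mxE; ring.
Qed.

(** The covariant derivative of [J], lowered by the metric, satisfies the
    hypotheses of [hermitian_defect_eq0]. *)
Theorem kahler_parallel u y : O y -> cov_end G u J y = 0.
Proof.
move=> Oy.
have skJ := fun q v w Oq => @kahler_skew q v w Oq.
apply: ip_inj => v w.
suff H : forall a b c : vec, ip (G y) (b *m cov_end G a J y) c = 0.
  have Z (b : vec) : b *m cov_end G u J y = 0.
    by apply: (ip_nondeg (G := G y)) => [z|z]; [exact: posG|exact: H].
  by rewrite /ip Z mul0mx mulmx0 mul0mx.
apply: (hermitian_defect_eq0 (j := fun a => a *m J y)).
- by move=> a b c; rewrite kahler_JJ // ipNr.
- move=> a b c; rewrite (cov_end_skew openO sG symG posG a Oy sJ skJ).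
  by rewrite (ipC (symG Oy)).
- move=> a b c; apply/esym.
  have /eqP := cov_end_sqr_anti a Oy; rewrite addr_eq0 => /eqP E.
  have := kahler_skew (b *m cov_end G a J y) c Oy.
  by rewrite -!mulmxA E mulmxN ipNl => /oppr_inj.
- move=> a b c; exact: kahler_form_cyclic.
- move=> a b c; have N := nijenhuis_cov_end a b Oy.
  have := kahler_skew (a *m cov_end G b J y) c Oy.
  have := kahler_skew (b *m cov_end G a J y) c Oy.
  move: N; move: (cov_end G (a *m J y) J y) (cov_end G (b *m J y) J y).
  move: (cov_end G a J y) (cov_end G b J y) => T1 T2 T3 T4 N s1 s2.
  move: N => /(congr1 (ip (G y) ^~ c)); rewrite ip0l !ipDl !ipNl s1 s2.
  by move: (ip _ _ _) (ip _ _ _) (ip _ _ _) (ip _ _ _) => p q r s; lra.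
Qed.

Definition riem_form (y u v w z : vec) : R := ip (G y) (w *m riem G u v y) z.

Lemma riem_form_kahler y : O y -> kahler_tensor (J y) (riem_form y).
Proof.
move=> Oy; split.
- by move=> u; exact: kahler_JJ.
- move=> a b u v x w z.
  rewrite /riem_form (riem_linear openO sG symG posG a b u v x Oy).
  move: (riem G u x y) (riem G v x y) => r1 r2.
  by rewrite mulmxDr -!scalemxAr ipDl !ipZl.
- by move=> a b u v x w z; rewrite /riem_form mulmxDl -!scalemxAl ipDl !ipZl.
- by move=> u v w z; rewrite /riem_form riem_antisym mulmxN ipNl.
- move=> u v w z; rewrite /riem_form (riem_skew openO sG symG posG u v w z Oy).
  by rewrite (ipC (symG Oy)).
- move=> u v w z; rewrite /riem_form -!ipDl (riem_bianchi openO sG symG posG u v w Oy).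
  exact: ip0l.
- move=> u v w z; rewrite /riem_form -mulmxA.
  rewrite (riem_parallel openO sG posG sJ (fun u q => @kahler_parallel u q)) //.
  by rewrite mulmxA (kahler_isom K).
Qed.

End KahlerParallel.

(** * Conformal change of a Kähler metric *)

(** The difference of two Koszul formulas, for the metrics [f ^+ 2 *: G] and [G]. *)
Lemma conformal_koszul {R : realFieldType}
    (f df1 df2 df3 g1 g2 g3 a b c p q : R) : f != 0 ->
  2 * (f ^+ 2 * p) =
    (2 * f * df1 * g1 + f ^+ 2 * a) + (2 * f * df2 * g2 + f ^+ 2 * b)
    - (2 * f * df3 * g3 + f ^+ 2 * c) ->
  2 * q = a + b - c ->
  p - q = df1 / f * g1 + df2 / f * g2 - df3 / f * g3.
Proof.
move=> f0 E1 E2; have -> : q = (a + b - c) / 2 by lra.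
have -> : p = (2 * (f ^+ 2 * p)) / (2 * f ^+ 2) by field.
by rewrite E1; field.
Qed.

Section Conformal.
Context {R : realType} {n : nat} (O : set 'rV[R]_n).
Hypothesis openO : open O.
Local Notation vec := 'rV[R]_n.
Variables (G J I : vec -> 'M[R]_n) (f : vec -> R).
Local Notation G' := (fun q => f q ^+ 2 *: G q).
Hypothesis K : kahler_on O G J.
Hypothesis K' : kahler_on O G' I.
Hypothesis smoothf : smooth_on O f.
Hypothesis posf : forall y, O y -> 0 < f y.
Let sG := kahler_smoothG K.
Let symG := kahler_symG K.
Let posG := kahler_posG K.
Let sG' := kahler_smoothG K'.
Let symG' := kahler_symG K'.
Let posG' := kahler_posG K'.

Let f0 y : O y -> f y != 0.
Proof. by move=> Oy; rewrite gt_eqF // posf. Qed.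

Definition dlog (v y : vec) : R := 'D_v f y / f y.

Lemma derive_conformal u v w y : O y ->
  ip ('D_u G' y) v w =
  2 * f y * 'D_u f y * ip (G y) v w + f y ^+ 2 * ip ('D_u G y) v w.
Proof.
move=> Oy.
have df : derivable f y u by exact: smooth_derivable smoothf Oy.
have sf2 : smooth_on O (fun q => f q ^+ 2).
  by apply: smooth_eq (smoothM openO smoothf smoothf) => // q _; rewrite expr2.
rewrite (derive_scalemx openO u sf2 sG Oy) ip_mxD !ip_mxZ.
congr (_ * _ + _).
have -> : 'D_u (fun q => f q ^+ 2) y = 'D_u (f * f) y.
  by apply: (derive_eq_on openO _ Oy) => q _; rewrite expr2.
apply: etrans (deriveM df df) _.
by move: ('D_u f y) => d; rewrite -[LHS]/(f y * d + f y * d); ring.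
Qed.

Lemma conn_conformal u v w y : O y ->
  ip (G y) (v *m conn G' u y) w - ip (G y) (v *m conn G u y) w =
  dlog u y * ip (G y) v w + dlog v y * ip (G y) u w - dlog w y * ip (G y) u v.
Proof.
move=> Oy.
have k := koszul openO sG posG u v w Oy.
have k' := koszul openO sG' posG' u v w Oy.
rewrite ip_mxZ in k'.
have k'' := etrans k' (congr2 (fun p q => p - q) (congr2 +%R
  (derive_conformal u v w Oy) (derive_conformal v u w Oy))
  (derive_conformal w u v Oy)).
exact: conformal_koszul (f0 Oy) k'' k.
Qed.

Lemma conformal_skew u v y : O y ->
  ip (G y) (u *m I y) v = - ip (G y) u (v *m I y).
Proof.
move=> Oy; have := kahler_skew K' u v Oy.
rewrite !ip_mxZ -mulrN => /mulfI; apply.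
by rewrite expf_neq0 // f0.
Qed.

(** [I] is parallel for the metric [f ^+ 2 *: G], so its derivative for [G] is the
    commutator of [I] with the difference of the connections, given by
    [conn_conformal]. *)
Lemma cov_end_conformal u v w y : O y ->
  ip (G y) (v *m cov_end G u I y) w =
  - dlog (v *m I y) y * ip (G y) u w + dlog w y * ip (G y) u (v *m I y)
  + dlog v y * ip (G y) (u *m I y) w + dlog (w *m I y) y * ip (G y) u v.
Proof.
move=> Oy.
have P : 'D_u I y = conn G' u y *m I y - I y *m conn G' u y.
  have /eqP := kahler_parallel openO K' u Oy.
  by rewrite /cov_end subr_eq0 => /eqP <-; rewrite addrK.
have c1 := conn_conformal u (v *m I y) w Oy.
have c2 := conn_conformal u v (w *m I y) Oy.
have s1 := conformal_skew (v *m conn G' u y) w Oy.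
have s2 := conformal_skew (v *m conn G u y) w Oy.
have s3 := conformal_skew v w Oy.
have s4 := conformal_skew u w Oy.
rewrite /cov_end P; move: c1 c2 s1 s2; move: (conn G' u y) (conn G u y) => N' N.
move=> c1 c2 s1 s2; rewrite s3 in c1.
rewrite !(mulmxBr, mulmxDr) !mulmxA !(ipDl, ipNl) s1 s2 s4.
move: c1 c2; move: (ip (G y) (v *m I y *m N') w) (ip (G y) (v *m I y *m N) w).
move: (ip (G y) (v *m N') (w *m I y)) (ip (G y) (v *m N) (w *m I y)).
move: (dlog u y) (dlog v y) (dlog w y) (dlog (v *m I y) y) (dlog (w *m I y) y).
move=> l1 l2 l3 l4 l5 a1 a2 a3 a4 c1 c2; lra.
Qed.

End Conformal.

(** * The Calabi condition in a chart *)

Section ScalarForms.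
Context {R : realType} {n : nat} (O : set 'rV[R]_n).
Hypothesis openO : open O.
Local Notation vec := 'rV[R]_n.

Lemma derive_coord (f : vec -> R) (v y : vec) : smooth_on O f -> O y ->
  'D_v f y = \sum_k v 0 k * 'D_(delta_mx 0 k) f y.
Proof.
move=> sf Oy; rewrite [in LHS](row_sum_delta v).
elim/big_rec2: _ => [|k x z _ <-]; first exact: derive0.
rewrite -[z in LHS]scale1r.
by apply: etrans (derive_linear openO _ _ _ _ sf Oy) _; rewrite mul1r.
Qed.

Lemma smooth_derive_along (f : vec -> R) (X : vec -> vec) :
  smooth_on O f -> smooth_on O X -> smooth_on O (fun y => 'D_(X y) f y).
Proof.
move=> sf /(smooth_mxP openO) sX.
have : smooth_on O (fun y => \sum_k X y 0 k * 'D_(delta_mx 0 k) f y).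
  apply: (@smooth_sum _ _ _ openO _ (index_enum 'I_n)
    (fun k y => X y 0 k * 'D_(delta_mx 0 k) f y)) => k.
  by apply: (smoothM openO (sX 0 k)); exact: smooth_derive.
by apply: smooth_eq => // y Oy; rewrite (derive_coord _ sf Oy).
Qed.

(** The left-hand and right-hand sides are the wedge products of [d a] with [d f] and
    of [d b] with [d h]: apply the exterior derivative to [a df = b dh]. *)
Lemma proportional_differentials (a b f h : vec -> R) (u v y : vec) :
  smooth_on O a -> smooth_on O b -> smooth_on O f -> smooth_on O h -> O y ->
  (forall w q, O q -> a q * 'D_w f q = b q * 'D_w h q) ->
  'D_u a y * 'D_v f y - 'D_v a y * 'D_u f y =
  'D_u b y * 'D_v h y - 'D_v b y * 'D_u h y.
Proof.
move=> sa sb sf sh Oy ab.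
have d (F H : vec -> R) (s t : vec) : smooth_on O F -> smooth_on O H ->
    'D_s (F * 'D_t H) y = F y * 'D_s ('D_t H) y + 'D_t H y * 'D_s F y.
  move=> sF sH; apply: deriveM; first exact: smooth_derivable sF Oy.
  exact: smooth_derivable (smooth_derive t sH) Oy.
have E s t : a y * 'D_s ('D_t f) y + 'D_t f y * 'D_s a y =
             b y * 'D_s ('D_t h) y + 'D_t h y * 'D_s b y.
  apply: etrans (esym (d a f s t sa sf)) (etrans _ (d b h s t sb sh)).
  by apply: (derive_eq_on openO _ Oy) => q Oq; exact: ab.
have Cf := derive_comm openO u v sf Oy; have Ch := derive_comm openO u v sh Oy.
have E1 := E u v; have E2 := E v u.
move: Cf Ch E1 E2.
move: ('D_u ('D_v f) y) ('D_v ('D_u f) y) => f1 f2.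
move: ('D_u ('D_v h) y) ('D_v ('D_u h) y) => h1 h2.
move: ('D_u f y) ('D_v f y) ('D_u h y) ('D_v h y) => fu fv hu hv.
move: ('D_u a y) ('D_v a y) ('D_u b y) ('D_v b y) => au av bu bv.
move=> -> -> E1 E2.
have -> : au * fv - av * fu = (a y * f1 + fv * au) - (a y * f1 + fu * av) by ring.
by rewrite E1 E2; ring.
Qed.

End ScalarForms.

Section CalabiChart.
Context {R : realType} {n : nat} (O : set 'rV[R]_n).
Hypothesis openO : open O.
Local Notation vec := 'rV[R]_n.
Variables (G J I : vec -> 'M[R]_n) (f h : vec -> R) (xi : vec -> vec).
Hypothesis K : kahler_on O G J.
Hypothesis K' : kahler_on O (fun q => f q ^+ 2 *: G q) I.
Hypothesis smoothf : smooth_on O f.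
Hypothesis posf : forall y, O y -> 0 < f y.
Hypothesis smoothh : smooth_on O h.
Hypothesis smoothxi : smooth_on O xi.
Hypothesis xi0 : forall y, O y -> xi y != 0.
Hypothesis killxi : forall X Y, smooth_on O X -> smooth_on O Y ->
  forall y, O y -> lie_metric xi G X Y y = 0.
Hypothesis hamxi : forall y v, O y ->
  kahler_form G J y (xi y) v = - 'D_v h y.
Hypothesis xiI : forall y, O y -> xi y *m I y = xi y *m J y.
Hypothesis xiJI : forall y, O y -> xi y *m J y *m I y = - xi y.
Hypothesis perpI : forall y z, O y -> perp (G y) (J y) (xi y) z ->
  z *m I y = - (z *m J y).
Hypothesis perp_neq0 : forall y, O y ->
  exists2 z : vec, z != 0 & perp (G y) (J y) (xi y) z.
Let sG := kahler_smoothG K.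
Let symG := kahler_symG K.
Let posG := kahler_posG K.
Let sJ := kahler_smoothJ K.
Let sI := kahler_smoothJ K'.
Let sc (a : vec) : smooth_on O (fun _ : vec => a) := smooth_cst openO a.

Definition nabla_mx (y : vec) : 'M[R]_n :=
  \matrix_(k, c) (cov G (delta_mx 0 k) xi y) 0 c.

Lemma nabla_mxE u y : O y -> u *m nabla_mx y = cov G u xi y.
Proof.
move=> Oy; apply/rowP => c; rewrite mxE.
rewrite /cov (derive_mx_coord openO u smoothxi Oy).
rewrite (conn_sym openO sG symG posG (xi y) u Oy).
rewrite mxE summxE [X in _ + X]mxE -big_split /=; apply: eq_bigr => k _.
rewrite mxE /cov [X in _ * X]mxE.
rewrite (conn_sym openO sG symG posG (xi y) (delta_mx 0 k) Oy) -rowE.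
rewrite mulrDr [X in X + _ = _]mulrC [row k _ _ _]mxE [in RHS]mxE.
by congr (_ + _); exact: mulrC.
Qed.

Lemma smooth_nabla_mx : smooth_on O nabla_mx.
Proof.
apply: smooth_mx_fun => // k c.
have s := smooth_cov openO sG posG (delta_mx 0 k : vec) smoothxi.
by move/(smooth_mxP openO): s; apply.
Qed.

Lemma nabla_mx_skew y (u v : vec) : O y ->
  ip (G y) (u *m nabla_mx y) v = - ip (G y) u (v *m nabla_mx y).
Proof.
move=> Oy; rewrite !nabla_mxE //.
have B (w : vec) : bracket xi (fun=> w) y = - 'D_w xi y.
  by rewrite /bracket derive_cst sub0r.
have := killxi (sc u) (sc v) Oy; rewrite /lie_metric (B u) (B v).
move: B => _; rewrite ipNl ipNr !opprK.
have -> : 'D_(xi y) (fun q => ip (G q) u v) y = ip ('D_(xi y) G y) u v.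
  have := derive_ip openO (xi y) sG (sc u) (sc v) Oy.
  by rewrite !derive_cst ip0l ip0r !addr0.
rewrite (conn_metric openO sG symG posG (xi y) u v Oy).
rewrite !(conn_sym openO sG symG posG _ (xi y) Oy) /cov ipDl ipDr.
move: ('D_u xi y) ('D_v xi y) => xu xv.
move: (ip (G y) xu v) (ip (G y) u xv) (ip (G y) (xi y *m conn G u y) v)
  (ip (G y) u (xi y *m conn G v y)) => a b c d E; lra.
Qed.

Let sxiJ : smooth_on O (fun q => xi q *m J q) := smooth_mulmx openO smoothxi sJ.

Lemma cov_xiJ u y : O y -> cov G u (fun q => xi q *m J q) y = u *m nabla_mx y *m J y.
Proof.
move=> Oy; rewrite (cov_mulmx openO G u Oy smoothxi sJ).
by rewrite (kahler_parallel openO K u Oy) mulmx0 addr0 nabla_mxE.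
Qed.

(** The field [xi *m J] is the gradient of [- h], so its covariant derivative is
    symmetric; as [nabla_mx] and [J] are skew, they commute. *)
Lemma nabla_mx_J y (u : vec) : O y ->
  u *m nabla_mx y *m J y = u *m J y *m nabla_mx y.
Proof.
move=> Oy.
have H (a b : vec) : - 'D_a ('D_b h) y =
    ip (G y) (a *m nabla_mx y *m J y) b + ip (G y) (xi y *m J y) (b *m conn G a y).
  rewrite -(cov_xiJ a Oy) -(cov_cst G b).
  rewrite -(derive_ip_cov openO sG symG posG a Oy sxiJ (sc b)).
  have db : derivable ('D_b h) y a.
    exact: smooth_derivable (smooth_derive b smoothh) Oy.
  apply: etrans (esym (deriveN db)) _.
  by apply: (derive_eq_on openO _ Oy) => q Oq; exact: esym (hamxi b Oq).
apply: (ip_extl (G := G y)) => [v|v]; first exact: posG.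
have C := congr1 -%R (derive_comm openO u v smoothh Oy).
have E := etrans (esym (H v u)) (etrans C (H u v)).
have e1 : ip (G y) (v *m nabla_mx y *m J y) u = ip (G y) (u *m J y *m nabla_mx y) v.
  rewrite (kahler_skew K _ _ Oy) (nabla_mx_skew v _ Oy) opprK.
  exact: ipC (symG Oy) _ _.
rewrite e1 (conn_sym openO sG symG posG u v Oy) in E.
exact: esym (addIr _ E).
Qed.

Definition dlog_at (y v : vec) : R := dlog f v y.

Lemma dlog_at_linear y a b u v : O y ->
  dlog_at y (a *: u + b *: v) = a * dlog_at y u + b * dlog_at y v.
Proof.
move=> Oy; rewrite /dlog_at /dlog.
have E := congr1 (fun p : R => p / f y) (derive_linear openO u v a b smoothf Oy).
by apply: etrans E _; rewrite mulrDl !mulrA.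
Qed.

Let Q (y : vec) : 'M[R]_n := J y - I y.
Let sQ : smooth_on O Q.
Proof. by apply: smooth_addmx => //; exact: smooth_oppmx. Qed.

Let cov_end_Q u y : O y -> cov_end G u Q y = - cov_end G u I y.
Proof.
by move=> Oy; rewrite (cov_end_sub openO G u Oy sJ sI) (kahler_parallel openO K u Oy) sub0r.
Qed.

Let skJ y u v (Oy : O y) := kahler_skew K u v Oy.
Let JJ y (Oy : O y) := fun u : vec => kahler_JJ K u Oy.

Let cov_mul0 (X : vec -> vec) (A : vec -> 'M[R]_n) u y : O y ->
  smooth_on O X -> smooth_on O A -> (forall q, O q -> X q *m A q = 0) ->
  cov G u X y *m A y + X y *m cov_end G u A y = 0.
Proof.
move=> Oy sX sA XA; rewrite -(cov_mulmx openO G u Oy sX sA).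
rewrite (cov_eq openO G u Oy XA) (cov_cst G (0 : vec)).
exact: mul0mx.
Qed.

(** The derivative of [xi *m (J - I) = 0]. *)
Lemma nabla_opposite u y : O y ->
  u *m nabla_mx y *m (J y - I y) = xi y *m cov_end G u I y.
Proof.
move=> Oy; have := cov_mul0 u Oy smoothxi sQ.
rewrite -nabla_mxE // cov_end_Q // mulmxN => E; apply/eqP; rewrite -subr_eq0.
by apply/eqP/E => q Oq; rewrite mulmxBr xiI // subrr.
Qed.

(** The derivative of [xi *m J *m (J - I) = 0]. *)
Lemma nabla_opposite_J u y : O y ->
  u *m nabla_mx y *m J y *m (J y - I y) = xi y *m J y *m cov_end G u I y.
Proof.
move=> Oy; have := cov_mul0 u Oy sxiJ sQ.
rewrite cov_xiJ // cov_end_Q // mulmxN => E; apply/eqP; rewrite -subr_eq0.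
apply/eqP/E => q Oq.
by rewrite /Q mulmxBr xiJI // (kahler_JJ K _ Oq) subrr.
Qed.

Lemma nabla_opposite_pairing y u z : O y ->
  ip (G y) (u *m nabla_mx y *m (J y - I y)) z =
  - dlog_at y (xi y *m I y) * ip (G y) u z + dlog_at y z * ip (G y) u (xi y *m I y)
  + dlog_at y (xi y) * ip (G y) (u *m I y) z + dlog_at y (z *m I y) * ip (G y) u (xi y).
Proof.
by move=> Oy; rewrite nabla_opposite // (cov_end_conformal openO K K' smoothf posf).
Qed.

Lemma calabi_at y : O y ->
  calabi_point (G y) (J y) (I y) (nabla_mx y) (xi y) (dlog_at y).
Proof.
move=> Oy; split.
- exact: symG.
- by move=> v; exact: posG.
- by move=> u v; exact: skJ.
- exact: JJ.
- exact: xi0.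
- exact: xiI.
- exact: xiJI.
- by move=> z; exact: perpI.
- by move=> u v; exact: nabla_mx_skew.
- by move=> u; exact: nabla_mx_J.
- by move=> a b u v; exact: dlog_at_linear.
- exact: perp_neq0.
- by move=> u z; exact: nabla_opposite_pairing.
Qed.

Let B (y : vec) : R := 'D_(xi y *m J y) f y.

Let sB : smooth_on O B.
Proof. by have := smooth_derive_along openO smoothf sxiJ. Qed.

Let sA := smooth_nabla_mx.

Let f0 y : O y -> f y != 0.
Proof. by move=> Oy; rewrite gt_eqF // posf. Qed.

(** The derivative of [nabla_xi_diff]. *)
Lemma nabla2_opposite u y : O y ->
  (u *m nabla_mx y *m nabla_mx y + xi y *m cov_end G u nabla_mx y) *m (J y - I y)
  = xi y *m nabla_mx y *m cov_end G u I y.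
Proof.
move=> Oy; have sxA := smooth_mulmx openO smoothxi sA.
have := cov_mul0 u Oy sxA sQ.
rewrite (cov_mulmx openO G u Oy smoothxi sA) -nabla_mxE // cov_end_Q // mulmxN => E.
apply/eqP; rewrite -subr_eq0; apply/eqP/E => q Oq.
exact: nabla_xi_diff (calabi_at Oq).
Qed.

Lemma cov_nabla_comm u y : O y ->
  cov_end G u nabla_mx y *m J y = J y *m cov_end G u nabla_mx y.
Proof.
move=> Oy.
have E : cov_end G u (fun q => nabla_mx q *m J q) y =
         cov_end G u (fun q => J q *m nabla_mx q) y.
  apply: (cov_end_eq openO G u Oy) => q Oq.
  by apply/row_matrixP => i; rewrite !rowE !mulmxA nabla_mx_J.
move: E; rewrite (cov_end_mulmx openO G u Oy sA sJ) (cov_end_mulmx openO G u Oy sJ sA).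
by rewrite (kahler_parallel openO K u Oy) mulmx0 mul0mx addr0 add0r.
Qed.

Lemma cov_nabla_skew u y v w : O y ->
  ip (G y) (v *m cov_end G u nabla_mx y) w = - ip (G y) v (w *m cov_end G u nabla_mx y).
Proof.
move=> Oy; apply: (cov_end_skew openO sG symG posG u Oy sA).
by move=> q a b Oq; exact: nabla_mx_skew.
Qed.

Lemma diff_nabla_on y : O y ->
  (2 * f y) *: (Q y *m nabla_mx y) = B y *: (Q y *m J y).
Proof.
move=> Oy; rewrite /Q (diff_nabla (calabi_at Oy)) scalerA; congr (_ *: _).
rewrite /dlog_at /dlog /B; move: ('D_(xi y *m J y) f y) => b.
by field; exact: f0.
Qed.

Let N (y : vec) : R := ip (G y) (xi y) (xi y).
Let sN : smooth_on O N := smooth_ip openO sG smoothxi smoothxi.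

(** [phi_proportional] with denominators cleared: the differentials of [f] and [h]
    are proportional. *)
Lemma dlog_hamiltonian w y : O y -> N y * 'D_w f y = - B y * 'D_w h y.
Proof.
move=> Oy; have := phi_proportional (calabi_at Oy) w.
rewrite -[ip _ (xi y *m J y) w]/(kahler_form G J y (xi y) w) hamxi //.
rewrite /dlog_at /dlog /N /B.
move: ('D_w f y) ('D_w h y) ('D_(xi y *m J y) f y) => a b c E.
have := f0 Oy; move: (f y) E => t E t0.
have -> : ip (G y) (xi y) (xi y) * a = t * (ip (G y) (xi y) (xi y) * (a / t)).
  by field.
by rewrite E; field.
Qed.

(** Evaluate [proportional_differentials] on [u] and [xi *m J]: on the orthogonal
    vector [u] the differentials of [f], [h] and [|xi|^2] vanish, and on [xi *m J]
    the differential of [h] is [- |xi|^2], which is not zero. *)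
Lemma dlog_xiJ_perp u y : O y -> perp (G y) (J y) (xi y) u -> 'D_u B y = 0.
Proof.
move=> Oy pu; have [u1 u2] := pu; have CP := calabi_at Oy.
have fu : 'D_u f y = 0.
  have := phi_perp CP pu; rewrite /dlog_at /dlog => /eqP.
  by rewrite mulf_eq0 invr_eq0 (negbTE (f0 Oy)) orbF => /eqP.
have hu : 'D_u h y = 0.
  have := hamxi u Oy; rewrite /kahler_form (ipC (symG Oy)) u2 => /eqP.
  by rewrite eq_sym oppr_eq0 => /eqP.
have hv : 'D_(xi y *m J y) h y = - N y.
  have := hamxi (xi y *m J y) Oy; rewrite /kahler_form (kahler_isom K) // => E.
  by rewrite /N E opprK.
have Nu : 'D_u N y = 0.
  have p0 : ip (G y) (u *m nabla_mx y) (xi y) = 0.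
    by rewrite (nabla_perp CP pu) ipZl (skJ _ _ Oy) u2 oppr0 mulr0.
  rewrite (derive_ip_cov openO sG symG posG u Oy smoothxi smoothxi).
  by rewrite -nabla_mxE // (ipC (symG Oy) (xi y)) p0 addr0.
have sNB : smooth_on O (- B) := smoothN openO sB.
have E := proportional_differentials openO u (xi y *m J y) sN sNB smoothf
  smoothh Oy (fun w q Oq => dlog_hamiltonian w Oq).
have dB : 'D_u (- B) y = - 'D_u B y.
  by apply: deriveN; exact: smooth_derivable sB Oy.
have E' : 'D_u B y * N y = 0.
  by move: E; rewrite Nu fu hu hv dB mul0r !mulr0 !subr0 mulrNN => <-.
have N0 : N y != 0 by rewrite gt_eqF // posG // xi0.
by move/eqP: E'; rewrite mulf_eq0 (negbTE N0) orbF => /eqP.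
Qed.

(** The derivative of [diff_nabla_on] along an orthogonal vector, where the
    derivatives of the coefficients vanish. *)
Lemma cov_nabla_perp u y : O y -> perp (G y) (J y) (xi y) u ->
  (J y - I y) *m cov_end G u nabla_mx y =
  cov_end G u I y *m (nabla_mx y - (dlog_at y (xi y *m J y) / 2) *: J y).
Proof.
move=> Oy pu; have CP := calabi_at Oy.
have s2f : smooth_on O (fun q => 2 * f q) :=
  smoothM openO (smooth_cst openO (2 : R)) smoothf.
have E := cov_end_eq openO G u Oy diff_nabla_on; move: E.
rewrite (cov_end_scale openO G u Oy s2f (smooth_mulmx openO sQ sA)).
rewrite (cov_end_scale openO G u Oy sB (smooth_mulmx openO sQ sJ)).
rewrite (cov_end_mulmx openO G u Oy sQ sA) (cov_end_mulmx openO G u Oy sQ sJ).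
rewrite (kahler_parallel openO K u Oy) cov_end_Q // mulmx0 addr0.
rewrite (dlog_xiJ_perp Oy pu) scale0r add0r.
have fu : 'D_u f y = 0.
  have := phi_perp CP pu; rewrite /dlog_at /dlog => /eqP.
  by rewrite mulf_eq0 invr_eq0 (negbTE (f0 Oy)) orbF => /eqP.
have -> : 'D_u (fun q => 2 * f q) y = 0.
  have df : derivable f y u by exact: smooth_derivable smoothf Oy.
  by apply: etrans (deriveZ 2 df) _; rewrite fu scaler0.
rewrite scale0r add0r /Q => E.
have -> : dlog_at y (xi y *m J y) / 2 = (2 * f y)^-1 * B y.
  rewrite /dlog_at /dlog /B; move: ('D_(xi y *m J y) f y) => b.
  by field; exact: f0.
have tf0 : 2 * f y != 0 by rewrite mulf_neq0 // f0.
apply: (scalerI tf0); move: E.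
move: (cov_end G u nabla_mx y) (cov_end G u I y) => dA dI E.
rewrite mulmxBr -scalemxAr scalerBr scalerA mulrA.
rewrite divff // mul1r; rewrite !mulNmx scalerDr !scalerN in E.
by rewrite -E addNKr.
Qed.

(** The Ricci identity for [xi]. *)
Lemma xi_riem u w y : O y ->
  w *m cov_end G u nabla_mx y - u *m cov_end G w nabla_mx y = xi y *m riem G u w y.
Proof.
move=> Oy; rewrite -(ricci_identity openO sG posG u w smoothxi Oy).
have E (a b : vec) : cov G a (cov G b xi) y =
    b *m conn G a y *m nabla_mx y + b *m cov_end G a nabla_mx y.
  have -> : cov G a (cov G b xi) y = cov G a (fun q => b *m nabla_mx q) y.
    by apply: (cov_eq openO G a Oy) => q Oq; rewrite nabla_mxE.
  by rewrite (cov_mulmx openO G a Oy (sc b) sA) cov_cst.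
rewrite (E u w) (E w u) (conn_sym openO sG symG posG u w Oy).
move: (cov_end G u nabla_mx y) (cov_end G w nabla_mx y) (_ *m nabla_mx y) => a b d.
by rewrite opprD addrACA subrr add0r.
Qed.

Lemma riem_form_xi u w z y : O y ->
  riem_form G y u w (xi y) z = xi_curv (G y) (fun v => cov_end G v nabla_mx y) u w z.
Proof. by move=> Oy; rewrite /riem_form -xi_riem // ipBl. Qed.

Lemma calabi_hol_form_split y : O y -> exists C, forall t z,
  perp (G y) (J y) (xi y) z ->
  hol_form (J y) (riem_form G y) (t *: xi y + z) =
  t ^+ 4 * hol_form (J y) (riem_form G y) (xi y) - 8 * C * t ^+ 2 * ip (G y) z z
  + hol_form (J y) (riem_form G y) z.
Proof.
move=> Oy; have CP := calabi_at Oy.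
have d1J u := nabla_opposite_J u Oy; have d2 u := nabla2_opposite u Oy.
have d0 u := cov_nabla_comm u Oy.
have sk u v w := cov_nabla_skew u v w Oy.
have d3 u (pu : perp (G y) (J y) (xi y) u) := cov_nabla_perp Oy pu.
have [C HC] := xi_curv_mixed CP d1J d2 sk.
exists C => t z pz.
have KT := riem_form_kahler openO K Oy.
apply: (hol_form_split KT (N := fun w => ip (G y) w w) (C := C)) pz.
- move=> w pw; exact: perpJ (fun u v => skJ u v Oy) (JJ Oy) _ pw.
- by move=> w; rewrite (kahler_isom K).
- by move=> w pw; rewrite riem_form_xi // (xi_curv_line CP d1J d2 d0).
- by move=> u v w pu pv pw; rewrite riem_form_xi // (xi_curv_perp CP d3).
- by move=> w pw; rewrite riem_form_xi // HC.
Qed.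

End CalabiChart.

(** * From charts to the surface *)

Section LineBundle.
Context {R : realType} {n : nat}.
Local Notation vec := 'rV[R]_n.

Lemma sub_col_mx2P (v x y : vec) :
  (v <= col_mx x y)%MS <-> exists a b, v = a *: x + b *: y.
Proof.
split=> [/submxP[c ->]|[a [b ->]]].
  exists (lsubmx c 0 0), (rsubmx c 0 0).
  by rewrite -[c in LHS]hsubmxK mul_row_col -!mul_scalar_mx -!mx11_scalar.
by rewrite addmx_sub // scalemx_sub // -addsmxE ?addsmxSl ?addsmxSr.
Qed.

Variables (G J : 'M[R]_n).
Hypothesis symG : G^T = G.
Hypothesis posG : forall v, v != 0 -> 0 < ip G v v.
Hypothesis skJ : forall u v, ip G (u *m J) v = - ip G u (v *m J).
Hypothesis JJ : forall u : vec, u *m J *m J = - u.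

Lemma ip_mx11 (u v : vec) : u *m G *m v^T = (ip G u v)%:M.
Proof. exact: mx11_scalar. Qed.

(** The two rows are orthogonal and of equal length, so a multiple of the
    transpose, lowered by the metric, is a right inverse. *)
Lemma complex_line_free (x : vec) : x != 0 -> row_free (col_mx x (x *m J)).
Proof.
move=> x0; have n0 : ip G x x != 0 by rewrite gt_eqF // posG.
apply/row_freeP.
exists ((ip G x x)^-1 *: (G *m (col_mx x (x *m J))^T)).
rewrite -scalemxAr tr_col_mx mul_mx_row mul_col_row !mulmxA !ip_mx11.
rewrite (ip_JJ skJ JJ) (ip_J_self symG skJ) skJ (ip_J_self symG skJ) oppr0.
rewrite raddf0 -scalar_mx_block scale_scalar_mx mulVf //.
Qed.

Lemma perp_kerP (x z : vec) :
  perp G J x z <-> (z <= kermx (G *m (col_mx x (x *m J))^T))%MS.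
Proof.
split=> [[z1 z2]|/sub_kermxP].
  apply/sub_kermxP; rewrite tr_col_mx mul_mx_row mul_mx_row !mulmxA !ip_mx11.
  by rewrite z1 z2 !raddf0 row_mx0.
rewrite tr_col_mx mul_mx_row mul_mx_row !mulmxA !ip_mx11 -row_mx0.
move=> /eq_row_mx[e1 e2].
have := congr1 (fun M : 'M[R]_1 => M 0 0) e1.
have := congr1 (fun M : 'M[R]_1 => M 0 0) e2.
by rewrite !mxE !mulr1n.
Qed.

Lemma rank_perp (x : vec) : x != 0 ->
  \rank (kermx (G *m (col_mx x (x *m J))^T)) = (n - 2)%N.
Proof.
move=> x0; rewrite mxrank_ker -mxrank_tr trmx_mul trmxK symG.
rewrite mxrankMfree; last by rewrite row_free_unit (metric_unit posG).
by have /eqP -> := complex_line_free x0.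
Qed.

End LineBundle.

Section Surface.
Context {R : realType}.
Local Notation vec := 'rV[R]_4.
Variables (G J : 'M[R]_4).
Hypothesis symG : G^T = G.
Hypothesis posG : forall v, v != 0 -> 0 < ip G v v.
Hypothesis skJ : forall u v, ip G (u *m J) v = - ip G u (v *m J).
Hypothesis JJ : forall u : vec, u *m J *m J = - u.

Lemma exists_perp (x : vec) : x != 0 -> exists2 z, z != 0 & perp G J x z.
Proof.
move=> x0; set P := kermx (G *m (col_mx x (x *m J))^T).
exists (nz_row P); last by apply/perp_kerP; exact: nz_row_sub.
by rewrite nz_row_eq0 -mxrank_eq0 (rank_perp symG posG skJ JJ x0).
Qed.

(** In real dimension four the complement of a complex line has dimension two, so
    it is spanned by any of its nonzero vectors [q] together with [q *m J]. *)
Lemma perp_plane (x q z : vec) : x != 0 -> q != 0 -> perp G J x q ->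
  perp G J x z -> exists a b, z = a *: q + b *: (q *m J).
Proof.
move=> x0 q0 pq /perp_kerP pz; apply/sub_col_mx2P; apply: submx_trans pz _.
have pqJ := perpJ skJ JJ pq.
have sub : (col_mx q (q *m J) <= kermx (G *m (col_mx x (x *m J))^T))%MS.
  by rewrite col_mx_sub; apply/andP; split; apply/perp_kerP.
have := mxrank_leqif_sup sub => -[_]; rewrite (rank_perp symG posG skJ JJ x0).
by have /eqP -> := complex_line_free symG posG skJ JJ q0; rewrite eqxx => <-.
Qed.

End Surface.

Section LinearIsometry.
Context {R : realType} {n : nat}.
Local Notation vec := 'rV[R]_n.
Variables (G H : 'M[R]_n) (F : vec -> vec).
Hypothesis posH : forall v, v != 0 -> 0 < ip H v v.
Hypothesis isoF : forall u v, ip H (F u) (F v) = ip G u v.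

(** The squared norm of the difference of both sides only involves inner products
    of values of [F]. *)
Lemma isometry_linear a b u v : F (a *: u + b *: v) = a *: F u + b *: F v.
Proof.
apply/eqP; rewrite -subr_eq0; apply/eqP/(ip_eq0 posH).
rewrite !(ipBl, ipBr, ipDl, ipDr, ipZl, ipZr) !isoF.
by rewrite !(ipDl, ipDr, ipZl, ipZr); ring.
Qed.

Hypothesis posG : forall v, v != 0 -> 0 < ip G v v.

Lemma isometry_inj u v : F u = F v -> u = v.
Proof.
move=> E; apply/eqP; rewrite -subr_eq0; apply/eqP/(ip_eq0 posG).
by rewrite ipBl !ipBr -!isoF E !subrr.
Qed.

End LinearIsometry.

Section CalabiIsQCH.
Context {R : realType} (M : smooth_manifold R 4).
Variables (g J I : chart M -> 'rV[R]_4 -> 'M[R]_4)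
  (xi : chart M -> 'rV[R]_4 -> 'rV[R]_4) (f h : M -> R).
Hypothesis Kg : kahler_surface g J.
Hypothesis Kf : kahler_surface (conformal f g) I.
Hypothesis smoothf : smooth_function f.
Hypothesis posf : forall x, 0 < f x.
Hypothesis kxi : killing g xi.
Hypothesis smoothh : smooth_function h.
Hypothesis hxi : forall i y v, chart_img M i y ->
  kahler_form (g i) (J i) y (xi i y) v = - 'D_v (h \o chart_inv M i) y.
Hypothesis xi0 : forall i y, chart_img M i y -> xi i y != 0.
Hypothesis opp : opposite_along g J xi I.
Local Notation vec := 'rV[R]_4.

Lemma kahler_surface_on (g' J' : chart M -> 'rV[R]_4 -> 'M[R]_4) i :
  kahler_surface g' J' -> kahler_on (chart_img M i) (g' i) (J' i).
Proof.
move=> [[sg symg posg _] [sJ _] JJ nij cl]; split.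
- exact: sg.
- exact: symg.
- by move=> y v Oy; exact: posg.
- exact: sJ.
- by move=> y Oy; have [] := JJ i y Oy.
- by move=> y u v Oy; have [_] := JJ i y Oy; apply.
- exact: nij.
- exact: cl.
Qed.

Let K i := kahler_surface_on i Kg.
Let openO i : open (chart_img M i).
Proof. exact: chart_img_open. Qed.

Definition calabi_distribution (i : chart M) (y : vec) : set vec :=
  [set v | (v <= col_mx (xi i y) (xi i y *m J i y))%MS].

Lemma calabi_distributionP i y v : calabi_distribution i y v <->
  exists a b, v = a *: xi i y + b *: (xi i y *m J i y).
Proof. exact: sub_col_mx2P. Qed.

Lemma push_isometry i j x u v : overlap i j x ->
  ip (g j (chart_map M j x)) (push i j x u) (push i j x v) =
  ip (g i (chart_map M i x)) u v.
Proof. by case: Kg => -[_ _ _ H] _ _ _ _; exact: H. Qed.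

Let img i x : chart_dom M i x -> chart_img M i (chart_map M i x).
Proof. by move=> dx; exists x. Qed.

(** The change of components is linear and injective because it preserves the
    metric, so it need not be differentiated. *)
Lemma calabi_distribution_push i j x v : overlap i j x ->
  calabi_distribution i (chart_map M i x) v <->
  calabi_distribution j (chart_map M j x) (push i j x v).
Proof.
move=> ov; have [/img Oi /img Oj] := ov.
have iso u w := push_isometry u w ov.
have lin := isometry_linear (F := push i j x) (fun w => kahler_posG (K j) Oj)
  iso.
have inj := isometry_inj iso (fun w => kahler_posG (K i) Oi).
have pxi : xi j (chart_map M j x) = push i j x (xi i (chart_map M i x)).
  by case: kxi => -[_ H] _; exact: H.
have pJ w : push i j x (w *m J i (chart_map M i x)) =
    push i j x w *m J j (chart_map M j x).
  by case: Kg => _ [_ H] _ _ _; exact: H.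
split=> /calabi_distributionP[a [b E]]; apply/calabi_distributionP; exists a, b.
  by rewrite E lin pJ pxi.
by apply: inj; rewrite E lin pJ pxi.
Qed.

Lemma calabi_distribution_smooth : smooth_distribution 2 calabi_distribution.
Proof.
split; last by move=> i j x v; exact: calabi_distribution_push.
move=> i y Oy.
exists (chart_img M i), (fun z => col_mx (xi i z) (xi i z *m J i z)); split => //.
  have sxi : smooth_on (chart_img M i) (xi i) by case: kxi => -[H _] _; exact: H.
  have sxiJ := smooth_mulmx (@openO i) sxi (kahler_smoothJ (K i)).
  exact: smooth_col_mx (@openO i) _ _ _ _ _ sxi sxiJ.
move=> z Oz; split => //.
apply: (complex_line_free (G := g i z)).
- exact: (kahler_symG (K i) Oz).
- by move=> w; exact: (kahler_posG (K i) Oz).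
- by move=> u w; exact: (kahler_skew (K i) _ _ Oz).
- by move=> u; exact: (kahler_JJ (K i) _ Oz).
- exact: xi0.
Qed.

Lemma calabi_distribution_J i y v : chart_img M i y ->
  calabi_distribution i y v -> calabi_distribution i y (v *m J i y).
Proof.
move=> Oy /calabi_distributionP[a [b ->]]; apply/calabi_distributionP; exists (- b), a.
by rewrite mulmxDl -!scalemxAl (kahler_JJ (K i) _ Oy) scalerN scaleNr addrC.
Qed.

Lemma calabi_hol_sect_curv i y : chart_img M i y ->
  exists k1 k2 k3, forall a b z, perp (g i y) (J i y) (xi i y) z ->
  hol_sect_curv (g i) (J i) y (a *: xi i y + b *: (xi i y *m J i y) + z) =
  (a ^+ 2 + b ^+ 2) ^+ 2 * k1 - k2 * (a ^+ 2 + b ^+ 2) * ip (g i y) z z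
  + k3 * ip (g i y) z z ^+ 2.
Proof.
move=> Oy.
have symG q (Oq : chart_img M i q) := kahler_symG (K i) Oq.
have posG q (Oq : chart_img M i q) w := kahler_posG (K i) (v := w) Oq.
have skJ q (Oq : chart_img M i q) u w := kahler_skew (K i) u w Oq.
have JJ q (Oq : chart_img M i q) (u : vec) := kahler_JJ (K i) u Oq.
have xiD q (Oq : chart_img M i q) a b :
    (a *: xi i q + b *: (xi i q *m J i q)) *m I i q =
    (a *: xi i q + b *: (xi i q *m J i q)) *m J i q.
  by have [H _] := opp Oq; apply: H; apply/sub_col_mx2P; exists a, b.
have xiI q : chart_img M i q -> xi i q *m I i q = xi i q *m J i q.
  by move=> Oq; have := xiD q Oq 1 0; rewrite scale1r scale0r addr0.
have xiJI q : chart_img M i q -> xi i q *m J i q *m I i q = - xi i q.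
  move=> Oq; have := xiD q Oq 0 1; rewrite scale1r scale0r add0r => ->.
  exact: JJ.
have perpI q z : chart_img M i q -> perp (g i q) (J i q) (xi i q) z ->
    z *m I i q = - (z *m J i q).
  move=> Oq [z1 z2]; have [_ H] := opp Oq; apply: H => w /sub_col_mx2P[a [b ->]].
  by rewrite ipDr !ipZr z1 z2 !mulr0 addr0.
have perp_ex q (Oq : chart_img M i q) :=
  exists_perp (symG q Oq) (posG q Oq) (skJ q Oq) (JJ q Oq) (xi0 Oq).
have sxi : smooth_on (chart_img M i) (xi i) by case: kxi => -[H _] _; exact: H.
have [C HC] := calabi_hol_form_split (@openO i) (K i) (kahler_surface_on i Kf)
  (smoothf i) (fun q _ => posf _) (smoothh i) sxi (fun q => @xi0 i q)
  (kxi.2 i) (fun q v => @hxi i q v) xiI xiJI perpI perp_ex Oy.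
have [q0 q00 pq0] := perp_ex y Oy.
have KT := riem_form_kahler (@openO i) (K i) Oy.
have plane z := perp_plane (symG y Oy) (posG y Oy) (skJ y Oy) (JJ y Oy)
  (xi0 Oy) q00 pq0 (z := z).
have F := hol_form_formula (symG y Oy) (posG y Oy) (skJ y Oy) KT q00 plane HC.
exists (hol_form (J i y) (riem_form (g i) y) (xi i y)), (8 * C),
  (hol_form (J i y) (riem_form (g i) y) q0 / ip (g i y) q0 q0 ^+ 2) => a b z pz.
rewrite -(F a b z pz) /hol_sect_curv.
apply: (curvE (@openO i) (kahler_smoothG (K i)) symG _ _ _ _ _ Oy).
by move=> q w Oq; exact: posG.
Qed.

(** The squared length of the component along the distribution determines that of
    the orthogonal one, since the vectors are unit vectors. *)
Lemma hol_sect_curv_determined i y u v p q : chart_img M i y ->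
  inorm (g i y) u = 1 -> inorm (g i y) v = 1 ->
  orth_proj (g i y) (calabi_distribution i y) u p ->
  orth_proj (g i y) (calabi_distribution i y) v q ->
  inorm (g i y) p = inorm (g i y) q ->
  hol_sect_curv (g i) (J i) y u = hol_sect_curv (g i) (J i) y v.
Proof.
move=> Oy nu nv pu pv npq.
have symG := kahler_symG (K i) Oy.
have posG w := kahler_posG (K i) (v := w) Oy.
have skJ u w := kahler_skew (K i) u w Oy.
have JJ (u : vec) := kahler_JJ (K i) u Oy.
have nn0 : ip (g i y) (xi i y) (xi i y) != 0 by rewrite gt_eqF // posG // xi0.
have sq w : ip (g i y) w w = inorm (g i y) w ^+ 2.
  by rewrite sqr_sqrtr // ip_ge0.
have [k1 [k2 [k3 F]]] := calabi_hol_sect_curv Oy.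
have split w s : orth_proj (g i y) (calabi_distribution i y) w s ->
    inorm (g i y) w = 1 -> exists a b z,
    [/\ w = a *: xi i y + b *: (xi i y *m J i y) + z,
        perp (g i y) (J i y) (xi i y) z,
        a ^+ 2 + b ^+ 2 = ip (g i y) s s / ip (g i y) (xi i y) (xi i y)
      & ip (g i y) z z = 1 - ip (g i y) s s].
  move=> [Ds orth] nw; have /calabi_distributionP[a [b E]] := Ds.
  exists a, b, (w - s).
  have orth' c d := orth _
    ((calabi_distributionP i y _).2 (ex_intro _ c (ex_intro _ d erefl))).
  split.
  - by rewrite -E addrC subrK.
  - split; first by have := orth' 1 0; rewrite scale1r scale0r addr0.
    by have := orth' 0 1; rewrite scale1r scale0r add0r.
  - rewrite E !(ipDl, ipDr, ipZl, ipZr) (ip_JJ skJ JJ) skJ (ip_J_self symG skJ).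
    by field.
  - have zs := orth _ Ds; rewrite ipBl in zs.
    by rewrite ipBr !ipBl zs subr0 (sq w) nw expr1n (ipC symG s w); lra.
have [a [b [z [-> pz r1 z1]]]] := split u p pu nu.
have [c [d [t [-> pt r2 t1]]]] := split v q pv nv.
by rewrite !F // r1 r2 z1 t1 !sq npq.
Qed.

End CalabiIsQCH.

Theorem theorem3 (R : realType) (M : smooth_manifold R 4)
    (g J : chart M -> 'rV[R]_4 -> 'M[R]_4) :
  connected [set: M] -> calabi_type g J -> qch g J.
Proof.
move=> conn [Kg [xi [kxi [h sh hxi] xi0 [I [opp [f [sf pf Kf]]]]]]].
split=> //; exists (calabi_distribution J xi); split.
- exact: (calabi_distribution_smooth Kg kxi xi0).
- by move=> i y v; exact: (calabi_distribution_J Kg).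
- exact: (hol_sect_curv_determined Kg Kf sf pf kxi sh hxi xi0 opp).
Qed.
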